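(* For each positive integer $n$ let $$P_n(z)=\frac{1}{\sqrt n}\sum_{j=0}^{n-1}e^{\pi i j^2/n}z^j,\qquad |z|=1 .$$ There exists a strictly increasing sequence $(n_k)_{k\ge1}$ of positive integers such that $$M(P_{n_k})=\exp\Big(\int_{S^1}\log|P_{n_k}(z)|\,dz\Big)\longrightarrow 1\qquad\text{as } k\to\infty .$$
   Context: $S^1=\{z\in\mathbb{C}:|z|=1\}$ is the unit circle and $dz$ denotes normalized Lebesgue measure on it. $M(P)=\exp\big(\int_{S^1}\log|P(z)|\,dz\big)$ is the Mahler measure of $P$. The polynomials $P_n$ are called Gauss--Fresnel (or Newman--Gauss) polynomials. *)

(* Defs.v *)
From HB Require Import structures.
From mathcomp Require Import all_boot all_order all_algebra.
From mathcomp Require Import complex.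
From mathcomp Require Import all_classical all_reals all_analysis.

Set Implicit Arguments.
Unset Strict Implicit.
Unset Printing Implicit Defensive.

Import Order.TTheory GRing.Theory Num.Theory.
Import numFieldNormedType.Exports.

Local Open Scope classical_set_scope.
Local Open Scope complex_scope.
Local Open Scope ring_scope.

(* [cis t] is $e^{it}$. *)
Definition cis (R : realType) (t : R) : R[i] := cos t +i* sin t.

(* Integral against the normalized Lebesgue measure of the unit circle, i.e.
   the image of the Lebesgue measure of [0, 1] under $t \mapsto e^{2\pi i t}$. *)
Definition circle_integral (R : realType) (f : R[i] -> \bar R) : \bar R :=
  (\int[lebesgue_measure]_(t in `[0%R, 1%R]) f (cis (2 * pi * t)))%E.

(* [lne 0 = -oo] and [expeR -oo = 0], so zeros of [p] on the circle and the
   case [p = 0] follow the usual conventions. [normc] is the modulus with values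
   in [R], whereas [`|z|] is valued in [R[i]]. *)
Definition mahler_measure (R : realType) (p : {poly R[i]}) : \bar R :=
  expeR (circle_integral (fun z => lne (ComplexField.Normc.normc p.[z])%:E)).

(* The coefficients are $e^{\pi i j^2/n}/\sqrt n$; as [0^-1 = 0], the polynomial
   is meaningful only for [n > 0]. *)
Definition gauss_fresnel (R : realType) (n : nat) : {poly R[i]} :=
  ((Num.sqrt (n%:R : R))^-1)%:C *:
    \poly_(j < n) cis (pi * (j%:R : R) ^+ 2 / n%:R).

(* Main.v *)
(* Write [P] for the polynomial [P_n], with [n] even. Its values at the [n]-th
   roots of unity have modulus exactly 1: the quadratic phases satisfy
   [z q^(1/2) Q(q z) = Q(z) - 1 + z^n] with [q = e^(2 pi i / n)] and
   [Q = sqrt n P], so these moduli are all equal, and Parseval fixes their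
   common value. Multiplying over the roots of unity,
     [1 = |a|^n * prod |1 - z^n|],
   the product being over the zeros [z] of [P] and [a] being its leading
   coefficient. Since [|1 - z^n| <= max(1, |z|)^n (1 + min(|z|, 1/|z|)^n)], the
   Mahler measure [|a| prod max(1, |z|)] is not much less than 1 if few zeros
   satisfy [1/B <= |z|^n <= B]. Away from the point 1 there is no such zero: by
   the functional equation and Abel summation, a zero would make [Q] small at
   most of the points [q^l z], contradicting Parseval on the circle through [z].
   The zeros close to 1 are few by Jensen's counting argument, as [|P(1)| = 1].
   The bound [M(P) <= 1] is [log y <= (y^2 - 1) / 2] and Parseval. *)
Require Import Defs.
From HB Require Import structures.
From mathcomp Require Import all_boot all_order all_algebra.
From mathcomp Require Import complex.
From mathcomp Require Import all_classical all_reals all_analysis.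
From mathcomp Require Import measurable_realfun.
From mathcomp Require Import zify ring lra.

Set Implicit Arguments.
Unset Strict Implicit.
Unset Printing Implicit Defensive.

Import Order.TTheory GRing.Theory Num.Theory.
Import numFieldNormedType.Exports.

Local Open Scope classical_set_scope.
Local Open Scope ring_scope.

Local Notation normc := ComplexField.Normc.normc.

(** * Modulus of complex numbers *)

Section Normc.
Local Open Scope complex_scope.
Variable R : realType.
Implicit Types (x y z : R[i]).

Lemma normcC z : (normc z)%:C = `|z|.
Proof. by case: z => a b; rewrite normc_def. Qed.

Lemma normc_ge0 z : 0 <= normc z.
Proof. by rewrite -lecR normcC normr_ge0. Qed.

Lemma normc_eq0 z : (normc z == 0) = (z == 0).
Proof. by rewrite -(inj_eq (@complexI R)) normcC normr_eq0. Qed.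

Lemma normc_gt0 z : (0 < normc z) = (z != 0).
Proof. by rewrite lt_neqAle eq_sym normc_eq0 normc_ge0 andbT. Qed.

Lemma normcM x y : normc (x * y) = normc x * normc y.
Proof. exact: ComplexField.Normc.normcM. Qed.

Lemma normcV x : normc x^-1 = (normc x)^-1.
Proof. exact: ComplexField.Normc.normcV. Qed.

Lemma normcX x n : normc (x ^+ n) = normc x ^+ n.
Proof. by apply: complexI; rewrite normcC normrX rmorphXn /= normcC. Qed.

Lemma normc_real (r : R) : normc r%:C = `|r|.
Proof. by rewrite /= expr0n addr0 sqrtr_sqr. Qed.

Lemma normcN x : normc (- x) = normc x.
Proof. by apply: complexI; rewrite !normcC normrN. Qed.

Lemma normcB x y : normc (x - y) = normc (y - x).
Proof. by rewrite -normcN opprB. Qed.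

Lemma normcD_le x y : normc (x + y) <= normc x + normc y.
Proof. by rewrite -lecR rmorphD /= !normcC ler_normD. Qed.

Lemma normc_dist x y : `|normc x - normc y| <= normc (x - y).
Proof.
have h (a b : R[i]) : normc a - normc b <= normc (a - b).
  by rewrite lerBlDr; have := normcD_le (a - b) b; rewrite subrK.
by rewrite ler_norml h lerNl opprB normcB h.
Qed.

Lemma normc_prod I (r : seq I) (F : I -> R[i]) :
  normc (\prod_(i <- r) F i) = \prod_(i <- r) normc (F i).
Proof.
apply: complexI; rewrite normcC normr_prod rmorph_prod /=.
by apply: eq_bigr => i _; rewrite normcC.
Qed.

Lemma normc_sum_le I (r : seq I) P (F : I -> R[i]) :
  normc (\sum_(i <- r | P i) F i) <= \sum_(i <- r | P i) normc (F i).
Proof.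
rewrite -lecR normcC (le_trans (ler_norm_sum _ _ _))// rmorph_sum /=.
by apply: ler_sum => i _; rewrite normcC.
Qed.

Lemma normc_sqrC x : ((normc x) ^+ 2)%:C = x * x^*%C.
Proof. by rewrite rmorphXn /= normcC sqr_normc. Qed.

End Normc.

(** * Roots of unity and discrete Parseval *)

Section Cis.
Local Open Scope complex_scope.
Variable R : realType.
Implicit Types (t a r : R).

Lemma cisD t a : cis (t + a) = cis t * cis a.
Proof.
by apply/eqP; rewrite eq_complex /= cosD sinD eqxx /=; apply/eqP; ring.
Qed.

Lemma cis0 : cis 0 = 1 :> R[i].
Proof. by rewrite /cis cos0 sin0. Qed.

Lemma normc_cis t : normc (cis t) = 1.
Proof. by rewrite /= cos2Dsin2 sqrtr1. Qed.

Lemma cis_neq0 t : cis t != 0.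
Proof. by rewrite -normc_gt0 normc_cis. Qed.

Lemma cisX t n : cis t ^+ n = cis (n%:R * t).
Proof.
elim: n => [|n IH]; first by rewrite expr0 mul0r cis0.
by rewrite exprS IH -cisD -natr1 mulrDl mul1r addrC.
Qed.

Lemma cis2pi : cis (2 * pi) = 1 :> R[i].
Proof. by rewrite /cis mulr_natl cos2pi sin2pi. Qed.

Lemma cis2pin n : cis (2 * pi * n%:R) = 1 :> R[i].
Proof. by rewrite mulrC -cisX cis2pi expr1n. Qed.

Lemma cisJ t : (cis t)^*%C = (cis t)^-1.
Proof.
apply: (mulIf (cis_neq0 t)); rewrite mulVf ?cis_neq0// mulrC -normc_sqrC.
by rewrite normc_cis expr1n.
Qed.

(** Law of cosines in half-angle form. Angles are written as [2 * a] from here on, so that distances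
    to 1 are governed by sines. *)
Lemma normc_cisB1_sqr r a :
  normc (r%:C * cis (2 * a) - 1) ^+ 2 = (r - 1) ^+ 2 + 4 * r * sin a ^+ 2.
Proof.
rewrite mulr_natl /cis cos_mulr2n sin_mulr2n /=.
rewrite sqr_sqrtr ?addr_ge0 ?sqr_ge0// !mul0r subr0 addr0.
have s2 := sin2cos2 a.
rewrite ?subr0 ?oppr0 ?addr0 exprMn.
have -> : ((cos a * sin a) *+ 2) ^+ 2 = 4 * cos a ^+ 2 * sin a ^+ 2 by ring.
rewrite s2; ring.
Qed.

Lemma normc_cisB1 a : normc (cis (2 * a) - 1) = 2 * `|sin a|.
Proof.
apply/eqP; rewrite -(@eqrXn2 _ 2)// ?normc_ge0 ?mulr_ge0//.
have := normc_cisB1_sqr 1 a; rewrite mul1r => ->.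
by rewrite exprMn real_normK ?num_real//; apply/eqP; ring.
Qed.

Definition ruroot n : R[i] := cis (2 * pi / n%:R).

Lemma prim_ruroot n : (0 < n)%N -> n.-primitive_root (ruroot n).
Proof.
move=> n0; have nR : (0 : R) < n%:R by rewrite ltr0n.
rewrite /primitive_root_of_unity n0; apply/forallP => i.
apply/eqP; rewrite unity_rootE cisX.
have [->|ni] := eqVneq i.+1 n; first
  by rewrite mulrC divfK ?cis2pi ?eqxx// gt_eqF.
apply/negbTE; rewrite -subr_eq0 -normc_gt0.
have -> : i.+1%:R * (2 * pi / n%:R) = 2 * (i.+1%:R * pi / n%:R) :> R
  by field; rewrite gt_eqF.
rewrite normc_cisB1 mulr_gt0// normr_gt0 gt_eqF// sin_gt0_pi//.
rewrite divr_gt0 ?mulr_gt0 ?ltr0n ?pi_gt0//=.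
rewrite ltr_pdivrMr// mulrC ltr_pM2l ?pi_gt0// ltr_nat.
by rewrite ltn_neqAle ni ltn_ord.
Qed.

(** This is the factorization of ['X^n - 1] over the roots of unity, evaluated at [v / u] and
    homogenized; [u = 0] is treated apart. *)
Lemma normc_prod_ruroot n (u v : R[i]) : (0 < n)%N ->
  \prod_(j < n) normc (u * ruroot n ^+ j - v) = normc (u ^+ n - v ^+ n).
Proof.
move=> n0; have [->|u0] := eqVneq u 0.
  under eq_bigr do rewrite mul0r sub0r normcN.
  by rewrite prodr_const card_ord expr0n gtn_eqF// sub0r normcN normcX.
have Xn1 : ('X^n - 1).[v / u] = (v / u) ^+ n - 1 by rewrite !hornerE.
have := factor_Xn_sub_1 (prim_ruroot n0).
move=> /(congr1 (fun p => normc (p.[v / u] * u ^+ n))).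
rewrite horner_prod Xn1 mulrBl mul1r -exprMn divfK// normcB => <-.
rewrite big_mkord normcM normcX normc_prod.
have -> : normc u ^+ n = \prod_(i < n) normc u by rewrite prodr_const card_ord.
rewrite -big_split /=.
apply: eq_bigr => i _; rewrite -normcM normcB; congr normc.
by rewrite !hornerE mulrBl divfK// [_ * u]mulrC.
Qed.

(** Orthogonality of characters: the summands form a geometric progression whose ratio is an [n]-th
    root of unity, and primitivity allows the ratio 1 only for [j = k]. *)
Lemma sum_ruroot n j k : (j < n)%N -> (k < n)%N ->
  \sum_(m < n) (ruroot n ^+ j * (ruroot n ^+ k)^*%C) ^+ m = (n * (j == k))%:R.
Proof.
move=> jn kn; have n0 : (0 < n)%N by exact: leq_trans kn.
have pr := prim_ruroot n0.
have cJ : (ruroot n ^+ k)^*%C = (ruroot n ^+ k)^-1 by rewrite cisX cisJ.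
set x := _ * _; have xn : x ^+ n = 1.
  have e i : (ruroot n ^+ i) ^+ n = 1.
    by rewrite -exprM mulnC exprM (prim_expr_order pr) expr1n.
  by rewrite /x cJ exprMn exprVn !e invr1 mulr1.
have [jk|jk] := eqVneq j k.
  have -> : x = 1 by rewrite /x jk cJ divff// cisX cis_neq0.
  by under eq_bigr do rewrite expr1n; rewrite sumr_const card_ord muln1.
rewrite muln0; have /eqP := subrX1 x n; rewrite xn subrr eq_sym mulf_eq0.
case/orP=> [|/eqP//]; rewrite subr_eq0 /x cJ => /eqP h.
have : ruroot n ^+ j == ruroot n ^+ k.
  by rewrite -[_ ^+ k]mul1r -h divfK// cisX cis_neq0.
by rewrite (eq_prim_root_expr pr) !modn_small// (negPf jk).
Qed.

(** Expanding the squares, orthogonality leaves the diagonal terms. The degree being below [n], no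
    two exponents agree modulo [n]. *)
Lemma discrete_parseval n (p : {poly R[i]}) (z : R[i]) : (size p <= n)%N ->
  \sum_(m < n) normc p.[z * ruroot n ^+ m] ^+ 2 =
  n%:R * \sum_(j < n) normc p`_j ^+ 2 * normc z ^+ (2 * j).
Proof.
move=> sp; apply: complexI; rewrite rmorph_sum /=.
pose b j := p`_j * z ^+ j; pose w := ruroot n.
transitivity (\sum_(m < n) \sum_(j < n) \sum_(k < n)
   (b j * (b k)^*%C) * ((w ^+ j * (w ^+ k)^*%C) ^+ m)).
  apply: eq_bigr => m _; rewrite normc_sqrC (horner_coef_wide _ sp).
  rewrite rmorph_sum /= mulr_suml; apply: eq_bigr => j _.
  rewrite mulr_sumr; apply: eq_bigr => k _.
  rewrite /b !exprMn -!exprM [(m * j)%N]mulnC [(m * k)%N]mulnC !exprM !rmorphM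
    /= !rmorphXn /=.
  by ring.
rewrite exchange_big /= rmorphM /= rmorph_sum /= mulr_sumr;
  apply: eq_bigr => j _.
rewrite exchange_big /= (bigD1 j)//= -mulr_sumr sum_ruroot// eqxx muln1.
rewrite big1 ?addr0 => [|k kj].
  rewrite [(2 * j)%N]mulnC exprM -(normcX z) -exprMn -normcM normc_sqrC
    rmorph_nat.
  by rewrite mulrC.
by rewrite -mulr_sumr sum_ruroot// eq_sym (inj_eq (@ord_inj n)) (negPf kj)
  muln0 mulr0.
Qed.

(** A discrete mean value property, from which a maximum principle is deduced in
    [horner_circle_ge]. *)
Lemma sum_horner_ruroot n (p : {poly R[i]}) : (size p <= n)%N ->
  \sum_(m < n) p.[ruroot n ^+ m] = n%:R * p`_0.
Proof.
move=> sp; have [n0|n0] := posnP n.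
  move: sp; rewrite n0 leqn0 size_poly_eq0 => /eqP ->;
    by rewrite big_ord0 coef0 mulr0.
under eq_bigr => m _ do rewrite (horner_coef_wide _ sp).
rewrite exchange_big /= (bigD1 (Ordinal n0))//=.
rewrite [X in _ + X]big1 ?addr0 => [|j j0].
  by under eq_bigr do rewrite expr0 mulr1;
    rewrite sumr_const card_ord mulr_natl.
rewrite -mulr_sumr; have := @sum_ruroot n j 0 (ltn_ord j) n0.
rewrite expr0 conjc1 mulr1.
under eq_bigr => m _ do rewrite -exprM mulnC exprM.
by move=> ->; rewrite -(inj_eq val_inj) /= in j0;
  rewrite (negPf j0) muln0 mulr0.
Qed.

End Cis.

(** * Jensen's inequality *)

Section Mean.
Local Open Scope complex_scope.
Variable R : realType.
Local Notation mu := (@lebesgue_measure R).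

Lemma continuous_primitive (g : R -> R) (a b : R) : a < b -> continuous g ->
  exists F : R -> R, forall x, a < x < b -> is_derive x 1 F (g x).
Proof.
move=> ab cg; exists (fun x => \int[mu]_(t in [set` `[a, x]]) (g t))%R =>
  x /andP[ax xb].
have gi : mu.-integrable `[a, b] (EFin \o g).
  apply: continuous_compact_integrable; first exact: segment_compact.
  exact: continuous_subspaceT.
have [dF F'] := continuous_FTC1_closed xb gi ax (cg x).
by rewrite -F' derive1E; exact: derivableP.
Qed.

(* For a primitive [F] of [g], the increment of [sum_j F (x + j / n)] between 0
   and [1 / n] telescopes to [F 1 - F 0]. *)
Lemma integral_unit_mean (g : R -> R) (n : nat) : continuous g -> (0 < n)%N ->
  exists x : R, (\int[mu]_(t in `[0%R, 1%R]) (g t)%:E =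
    (n%:R^-1 * \sum_(j < n) g (x + j%:R / n%:R))%:E)%E.
Proof.
move=> cg n0; have nR : (0 : R) < n%:R by rewrite ltr0n.
have n1 : (n%:R^-1 : R) <= 1 by rewrite invf_le1// ler1n.
(* The interval [(-1, 3)] contains all points [x + j / n] with [-1 < x < 2], so [F] is
   differentiable also at the ends of the intervals used below. *)
have [F dF] := @continuous_primitive g (-1) 3 ltac:(lra) cg.
have cF (x : R) : -1 < x < 3 -> {for x, continuous F}.
  move=> x13; apply: differentiable_continuous; apply/derivable1_diffP.
  by have [] := dF x x13.
have -> : (\int[mu]_(t in `[0%R, 1%R]) (g t)%:E = (F 1 - F 0)%:E)%E.
  rewrite EFinB; apply: continuous_FTC2 => //.
  - exact: continuous_subspaceT.
  - split.
    + by move=> x; rewrite in_itv /= => x01; have [|] := dF x => //; lra.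
    + by apply: cvg_at_right_filter; apply: cF; lra.
    + by apply: cvg_at_left_filter; apply: cF; lra.
  - move=> x; rewrite in_itv /= => x01; rewrite derive1E.
    by have [|_ ->] := dF x => //; lra.
pose H (x : R) := \sum_(j < n) F (x + j%:R / n%:R).
pose h (x : R) := \sum_(j < n) g (x + j%:R / n%:R).
have bj (x : R) (j : 'I_n) : -1 < x < 2 -> -1 < x + j%:R / n%:R < 3.
  have : (j%:R / n%:R : R) <= 1 by rewrite ler_pdivrMr// mul1r ler_nat ltnW.
  have : (0 : R) <= j%:R / n%:R by rewrite divr_ge0.
  by lra.
have dH (x : R) : -1 < x < 2 -> is_derive x 1 H (h x).
  move=> x12; rewrite (_ : H = \sum_(j < n) (fun x => F (x + j%:R / n%:R)));
    last first.
    by apply/funext => y; rewrite fct_sumE.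
  apply: is_derive_sum => j; have dj := dF _ (bj x j x12).
  have dt : is_derive x 1 (fun x => x + j%:R / n%:R : R) 1.
    by rewrite -[X in is_derive _ _ _ X]addr0; apply: is_deriveD.
  by have := @is_derive1_comp R F (fun x => x + j%:R / n%:R) x _ _ dj dt;
    rewrite mulr1.
have nV : (0 : R) < n%:R^-1 by rewrite invr_gt0.
have cH : {within `[0, (n%:R^-1 : R)], continuous H}.
  apply: continuous_in_subspaceT => x; rewrite inE /= in_itv /= => /andP[xa xb].
  apply: differentiable_continuous; apply/derivable1_diffP.
  by have [|] := dH x => //; lra.
have [|c _] := @MVT R H h 0 n%:R^-1 nV _ cH.
  by move=> x; rewrite in_itv /= => x01; apply: dH; lra.
rewrite subr0 mulrC => E; exists c; congr EFin; rewrite -/(h c) -E /H -sumrB.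
have -> : F 1 - F 0 = \sum_(0 <= j < n) (F (j.+1%:R / n%:R) - F (j%:R / n%:R)).
  by rewrite (telescope_sumr (fun j => F (j%:R / n%:R)))// mul0r divff// gt_eqF.
rewrite big_mkord; apply: eq_bigr => j _; rewrite add0r.
by rewrite [n%:R^-1 + _]addrC -natr1 mulrDl mul1r.
Qed.

End Mean.

(** * Jensen's inequality for polynomials without zeros on the circle *)

Section Jensen.
Local Open Scope complex_scope.
Variable R : realType.
Local Notation mu := (@lebesgue_measure R).
Local Notation circ t := (cis (2 * pi * t) : R[i]).

Lemma continuous_normc_circ (p : {poly R[i]}) :
  continuous (fun t : R => normc p.[circ t]).
Proof.
pose z t := circ t.
have c2 : continuous (fun t : R => 2 * pi * t).
  by move=> t; apply: cvgM; [exact: cvg_cst|exact: cvg_id].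
have cR : continuous (fun t : R => complex.Re (z t)).
  by move=> t; exact: (continuous_comp (c2 t) (@continuous_cos _ _)).
have cI : continuous (fun t : R => complex.Im (z t)).
  by move=> t; exact: (continuous_comp (c2 t) (@continuous_sin _ _)).
have [cpR cpI] : continuous (fun t : R => complex.Re p.[z t]) /\
                 continuous (fun t : R => complex.Im p.[z t]).
  elim/poly_ind: p => [|p c [IHR IHI]].
    by split => t; rewrite /continuous_at; under eq_fun do rewrite horner0 /=;
       rewrite horner0; exact: cvg_cst.
  have ER t : complex.Re (p * 'X + c%:P).[z t] = complex.Re p.[z t] *
    complex.Re (z t) -
      complex.Im p.[z t] * complex.Im (z t) + complex.Re c.
    by rewrite hornerMXaddC; case: (p.[z t]) => [a b];
      case: (z t) => [a' b']; case: (c).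
  have EI t : complex.Im (p * 'X + c%:P).[z t] = complex.Re p.[z t] *
    complex.Im (z t) +
      complex.Im p.[z t] * complex.Re (z t) + complex.Im c.
    by rewrite hornerMXaddC; case: (p.[z t]) => [a b];
      case: (z t) => [a' b']; case: (c).
  split => t; rewrite /continuous_at.
    under eq_fun do rewrite ER; rewrite ER.
    apply: cvgD; last exact: cvg_cst.
    by apply: cvgB; apply: cvgM; [exact: IHR|exact: cR|exact: IHI|exact: cI].
  under eq_fun do rewrite EI; rewrite EI.
  apply: cvgD; last exact: cvg_cst.
  by apply: cvgD; apply: cvgM; [exact: IHR|exact: cI|exact: IHI|exact: cR].
have E t : normc p.[z t] = Num.sqrt (complex.Re p.[z t] ^+ 2 + complex.Im p.[z
  t] ^+ 2).
  by case: (p.[_]).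
move=> t; rewrite /continuous_at; under eq_fun do rewrite E; rewrite E.
apply: (@continuous_comp _ _ _ (fun t =>
  complex.Re p.[z t] ^+ 2 + complex.Im p.[z t] ^+ 2) Num.sqrt);
    last exact: sqrt_continuous.
by apply: cvgD; apply: cvgM; [exact: cpR|exact: cpR|exact: cpI|exact: cpI].
Qed.

Lemma circD (x : R) (n j : nat) : circ (x + j%:R / n%:R) = circ x * ruroot R n
  ^+ j.
Proof. by rewrite mulrDr cisD cisX; congr (_ * cis _); ring. Qed.

(** The minimum treats zeros inside and outside the disc alike. At [z = 0] the convention [0^-1 = 0]
    gives the value 1. *)
Definition root_gap (z : R[i]) : R := 1 - Num.min (normc z) (normc z)^-1.

Lemma root_gap_gt0 z : normc z != 1 -> 0 < root_gap z.
Proof.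
rewrite /root_gap subr_gt0 gt_min; have := normc_ge0 z; move: (normc z) => x x0.
by rewrite neq_lt => /orP[->//|x1];
  rewrite invf_lt1 ?x1 ?orbT// (lt_trans _ x1).
Qed.

(** With [x = |z|], use [1 - x^n >= 1 - x] inside the disc and [x^n - 1 >= x^n (1 - 1/x)] outside.
    The loss is a factor independent of [n], which disappears after taking [n]-th roots. *)
Lemma root_gap_le (z u : R[i]) (n : nat) : (0 < n)%N -> normc u = 1 -> normc z
  != 1 ->
  root_gap z * Num.max 1 (normc z) ^+ n <= normc (u ^+ n - z ^+ n).
Proof.
move=> n0 u1 z1; apply: le_trans (ler_norm _) _; rewrite -normrN.
apply: le_trans (normc_dist _ _).
rewrite !normcX u1 expr1n /root_gap; have := normc_ge0 z;
  move: (normc z) z1 => x x1 x0.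
have [xle|xlt] := leP x 1.
  have {x1}xlt : x < 1 by rewrite lt_neqAle x1.
  have xx : x ^+ n <= x by case: n n0 => // n _;
    rewrite exprS ler_piMr// exprn_ile1.
  have -> : Num.min x x^-1 = x.
    apply/min_idPl; have [->|xn] := eqVneq x 0; first by rewrite invr0.
    have x0' : 0 < x by rewrite lt_neqAle eq_sym xn.
    by rewrite (le_trans xle)// invf_ge1.
  rewrite normrN expr1n mulr1 ger0_norm; last by lra.
  by rewrite ger0_norm; lra.
have -> : Num.min x x^-1 = x^-1.
  by apply/min_idPr; rewrite (le_trans _ (ltW xlt))// invf_le1 ?ltW//
    (lt_trans _ xlt).
have x0' : 0 < x by rewrite (lt_trans _ xlt).
have xV : x^-1 < 1 by rewrite invf_lt1.
have x1n : x <= x ^+ n by case: n n0 => // n _;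
  rewrite exprS ler_peMr// exprn_ege1// ltW.
rewrite normrN ger0_norm; last by rewrite mulr_ge0 ?exprn_ge0 ?subr_ge0 ?ltW.
rewrite distrC ger0_norm ?subr_ge0; last by lra.
rewrite mulrBl mul1r lerD2l lerN2 -(ler_pM2l x0') mulr1 mulrA divff ?gt_eqF//
  mul1r.
exact: x1n.
Qed.

Lemma prodr_gt0_seq (T : eqType) (r : seq T) (F : T -> R) :
  (forall x, x \in r -> 0 < F x) -> 0 < \prod_(x <- r) F x.
Proof. by move=> h; rewrite big_seq; apply: prodr_gt0. Qed.

Lemma ler_prod_seq (T : eqType) (r : seq T) (F G : T -> R) :
  (forall x, x \in r -> 0 <= F x <= G x) ->
  \prod_(x <- r) F x <= \prod_(x <- r) G x.
Proof. by move=> h; rewrite big_seq [leRHS]big_seq; apply: ler_prod. Qed.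

(* Averaging over [n] equidistant points turns each factor [|x - z|] into
   [|x^n - z^n|]; then [n] tends to infinity. *)
Lemma jensen_off_circle (p : {poly R[i]}) (a : R[i]) (r : seq R[i]) :
  a != 0 -> (forall z, z \in r -> normc z != 1) ->
  p = a *: \prod_(z <- r) ('X - z%:P) ->
  ((ln (normc a * \prod_(z <- r) Num.max 1 (normc z)))%:E <=
   \int[mu]_(t in `[0%R, 1%R]) (ln (normc p.[circ t]))%:E)%E.
Proof.
move=> a0 r1 pE'.
have pE x : normc p.[x] = normc a * \prod_(z <- r) normc (x - z).
  rewrite pE' hornerZ normcM horner_prod normc_prod; congr (_ * _).
  by apply: eq_bigr => z _; rewrite !hornerE.
have xz (x z : R[i]) : normc x = 1 -> z \in r -> 0 < normc (x - z).
  move=> x1 zr; rewrite normc_gt0 subr_eq0; apply: contraNneq (r1 z zr) => <-.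
  by rewrite x1.
have a0' : 0 < normc a by rewrite normc_gt0.
have p0 t : 0 < normc p.[circ t].
  by rewrite pE mulr_gt0// prodr_gt0_seq// => z zr; rewrite xz// normc_cis.
have cg : continuous (fun t : R => ln (normc p.[circ t])).
  move=> t; apply: continuous_comp (@continuous_normc_circ p t) _.
  exact: continuous_ln.
set Q := \prod_(z <- r) _.
have Q0 : 0 < Q by apply: prodr_gt0_seq => z _; rewrite lt_max ltr01.
pose D := \prod_(z <- r) root_gap z.
have D0 : 0 < D by apply: prodr_gt0_seq => z zr; rewrite root_gap_gt0// r1.
have mean n : (0 < n)%N -> exists x : R,
    (\int[mu]_(t in `[0%R, 1%R]) (ln (normc p.[circ t]))%:E = x%:E)%E /\
    n%:R * ln (normc a * Q) + ln D <= n%:R * x.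
  move=> n0; have [x ->] := integral_unit_mean cg n0.
  eexists; split; first by [].
  have nR : (n%:R : R) != 0 by rewrite pnatr_eq0 -lt0n.
  rewrite mulrA divff// mul1r -ler_expR expRD mulrC expRM_natl lnK ?posrE
    ?mulr_gt0//.
  rewrite lnK ?posrE ?mulr_gt0// expR_sum.
  under eq_bigr => j _ do rewrite lnK ?posrE// circD pE.
  rewrite big_split /= prodr_const card_ord exprMn mulrCA ler_pM2l ?exprn_gt0//.
  rewrite exchange_big /= -prodrXl -big_split /=; apply: ler_prod_seq => z zr.
  rewrite normc_prod_ruroot// root_gap_le ?r1 ?normc_cis ?andbT//.
  by apply: mulr_ge0; [rewrite ltW// root_gap_gt0// r1|rewrite exprn_ge0//
    le_max ler01].
(* The instance [n = 1] only serves to name the integral as a real number [x]. Were [x] too small,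
   [n] times the deficit would exceed the fixed quantity [- ln D] for large [n]. *)
have [x [Ix _]] := mean 1%N isT; rewrite Ix lee_fin leNgt; apply/negP => lx.
have [n nD] : exists n, (0 < n)%N /\ - ln D < n%:R * (ln (normc a * Q) - x).
  have d0 : 0 < ln (normc a * Q) - x by rewrite subr_gt0.
  exists (Num.truncn (`|ln D| / (ln (normc a * Q) - x))).+1; split => //.
  rewrite -ltr_pdivrMr//; apply: le_lt_trans (truncnS_gt _).
  by rewrite ler_pM2r ?invr_gt0// -normrN ler_norm.
case: nD => n0 nD; have [y [Iy ly]] := mean n n0.
move: Iy; rewrite Ix => -[xy]; move: ly nD; rewrite -xy mulrBr.
by rewrite ltrBrDr -lerBrDr addrC => /lt_le_trans h /h; rewrite ltxx.
Qed.

End Jensen.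

(** * Jensen's inequality with zeros on the circle *)

Section JensenFull.
Local Open Scope complex_scope.
Variable R : realType.
Local Notation mu := (@lebesgue_measure R).
Local Notation circ t := (cis (2 * pi * t) : R[i]).

Lemma limn_einf_le_lim (u v : (\bar R)^nat) l :
  (forall n, u n <= v n)%E -> v @ \oo --> l -> (limn_einf u <= l)%E.
Proof.
move=> uv vl; rewrite limn_einf_lim -(cvg_lim _ vl)//.
apply: lee_lim; [exact: is_cvg_einfs|by apply/cvg_ex; exists l|].
apply: nearW => n; apply: le_trans (uv n); apply: ereal_inf_lbound.
by exists n => /=.
Qed.

(** Circles with radius in [[s, 1)] then carry no zero, so the unit circle can be approached from
    inside. *)
Lemma root_moduli_gap (r : seq R[i]) :
  exists2 s : R, 0 < s < 1 & forall z, z \in r -> normc z < 1 -> normc z < s.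
Proof.
elim: r => [|z r [s /andP[s0 s1] IH]]; first by exists (2^-1) => //; lra.
have [z1|z1] := leP 1 (normc z).
  exists s; first by rewrite s0.
  by move=> w; rewrite inE => /predU1P[->|/IH//]; rewrite ltNge z1.
exists (Num.max s ((normc z + 1) / 2)).
  by rewrite lt_max s0 gt_max s1 /=; lra.
move=> w; rewrite inE => /predU1P[-> _|/IH h /h ws]; last by rewrite lt_max ws.
by rewrite lt_max; apply/orP; right; lra.
Qed.

Definition log_circ (p : {poly R[i]}) (t : R) : \bar R :=
  lne (normc p.[circ t])%:E.

Lemma measurable_log_circ (p : {poly R[i]}) : measurable_fun [set: R] (log_circ
  p).
Proof.
have mp : measurable_fun [set: R] (fun t : R => normc p.[circ t]).
  by apply: continuous_measurable_fun; exact: continuous_normc_circ.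
apply: measurable_fun_ifT.
- by apply: measurable_fun_ler.
- exact: measurable_cst.
- by apply/measurable_EFinP; exact: measurableT_comp.
Qed.

Lemma cvg_prod_dist (a : R) (r : seq R[i]) (u : R[i]) (s : R^nat) : s @ \oo -->
  (1 : R) ->
  normc u = 1 ->
  a * \prod_(z <- r) normc ((s k)%:C * u - z) @[k --> \oo] -->
  a * \prod_(z <- r) normc (u - z).
Proof.
move=> s1 u1; apply: cvgM; first exact: cvg_cst.
elim: r => [|z r IH].
  by rewrite big_nil; under eq_fun do rewrite big_nil; exact: cvg_cst.
rewrite big_cons; under eq_fun do rewrite big_cons.
apply: cvgM => //; apply/cvgrPdist_le => e e0.
move/cvgrPdist_le : s1 => /(_ _ e0); apply: filterS => k.
apply: le_trans; apply: le_trans (normc_dist _ _) _.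
have -> : u - z - ((s k)%:C * u - z) = (1 - s k)%:C * u.
  by rewrite rmorphB /=; ring.
by rewrite normcM u1 mulr1 normc_real.
Qed.

Lemma integrable_unit_itv (g : R -> R) : continuous g ->
  mu.-integrable `[0%R, 1%R] (EFin \o g).
Proof.
move=> cg; apply: continuous_compact_integrable; first exact: segment_compact.
exact: continuous_subspaceT.
Qed.

Lemma integral_unit_cst (c : R) : (\int[mu]_(t in `[0%R, 1%R]) c%:E = c%:E)%E.
Proof.
have m1 : mu `[0%R, 1%R]%classic = 1%E.
  by rewrite lebesgue_measure_itv /= lte_fin ltr01 oppr0 adde0.
by rewrite -[RHS]mule1 -m1; exact: (integral_cst mu (measurable_itv _) c%:E).
Qed.

Lemma prod_normc_scale (c x : R[i]) (r : seq R[i]) : c != 0 ->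
  \prod_(z <- [seq z / c | z <- r]) normc (x - z) * normc c ^+ size r =
  \prod_(z <- r) normc (c * x - z).
Proof.
move=> c0; elim: r => [|z r IH]; first by rewrite !big_nil mul1r.
rewrite /= !big_cons -IH exprSr.
have -> : c * x - z = (x - z / c) * c by rewrite mulrBl divfK// mulrC.
by rewrite normcM; ring.
Qed.

(** This is the lower half of Jensen's formula. Integrability comes with it: the bound that Fatou's
    lemma gives for [ln C - log_circ p] also excludes an integral equal to [-oo]. *)
Lemma jensen (p : {poly R[i]}) (a : R[i]) (r : seq R[i]) :
  a != 0 -> p = a *: \prod_(z <- r) ('X - z%:P) ->
  mu.-integrable `[0%R, 1%R] (log_circ p) /\
  ((ln (normc a * \prod_(z <- r) Num.max 1 (normc z)))%:E <=
   \int[mu]_(t in `[0%R, 1%R]) log_circ p t)%E.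
Proof.
move=> a0 pE'; have a0' : 0 < normc a by rewrite normc_gt0.
have pE x : normc p.[x] = normc a * \prod_(z <- r) normc (x - z).
  rewrite pE' hornerZ normcM horner_prod normc_prod; congr (_ * _).
  by apply: eq_bigr => z _; rewrite !hornerE.
set Q := \prod_(z <- r) Num.max _ _.
have Q0 : 0 < Q by apply: prodr_gt0_seq => z _; rewrite lt_max ltr01.
(* The circles of radii [s k] avoid all roots; Fatou's lemma lets [k] tend to
   infinity. *)
have [s0 /andP[s00 s01] rs0] := root_moduli_gap r.
pose s k := 1 - (1 - s0) * k.+1%:R^-1 : R.
have sP k : s0 <= s k < 1.
  have k0 : (0 : R) < k.+1%:R^-1 by rewrite invr_gt0.
  have k1 : k.+1%:R^-1 <= 1 :> R by rewrite invf_le1// ler1n.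
  rewrite /s; apply/andP; split; last
    by rewrite ltrBlDr ltrDl mulr_gt0// subr_gt0.
  by rewrite lerBrDr addrC -lerBrDr ler_piMr// subr_ge0 ltW.
have s_gt0 k : 0 < s k by case/andP: (sP k) => + _; apply: lt_le_trans.
have s_cvg : s @ \oo --> (1 : R).
  rewrite -[X in _ --> X]subr0 -[X in _ - X](mulr0 (1 - s0)); apply: cvgB;
    first exact: cvg_cst.
  by apply: cvgM; [exact: cvg_cst|exact: cvg_harmonic].
pose d := size r.
(* The polynomial [p] at [s k * x], in factored form: the zeros move to [z / s k], none of them on
   the unit circle. *)
pose q k := (a * (s k)%:C ^+ d) *: \prod_(z <- [seq z / (s k)%:C | z <- r]) ('X
  - z%:P).
have sC0 k : (s k)%:C != 0 by rewrite -(rmorph0 (real_complex R)) (inj_eq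
  (@complexI R)) gt_eqF.
have qE k x : normc (q k).[x] = normc p.[(s k)%:C * x].
  rewrite pE /q hornerZ !normcM horner_prod normc_prod -mulrA; congr (_ * _).
  rewrite mulrC normcX -prod_normc_scale//; congr (_ * _).
  by apply: eq_bigr => z _; rewrite !hornerE.
have q_root1 k z : z \in [seq z / (s k)%:C | z <- r] -> normc z != 1.
  case/mapP => w wr ->; rewrite normcM normcV normc_real gtr0_norm//.
  apply/eqP => /(congr1 (fun x => x * s k)); rewrite divfK ?gt_eqF// mul1r => e.
  case/andP: (sP k); rewrite -e => h1 h2.
  by have := rs0 w wr h2; rewrite ltNge h1.
have q_lead k : a * (s k)%:C ^+ d != 0 by rewrite mulf_neq0// expf_neq0.
have qJ k := jensen_off_circle (q_lead k) (@q_root1 k) erefl.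
pose L := ln (normc a * Q).
(* Dividing zeros by [s k < 1] can only enlarge the maxima; the leading coefficient costs
   [d * ln (s k)], which tends to 0. *)
have qL k : L + d%:R * ln (s k) <= ln (normc (a * (s k)%:C ^+ d) *
    \prod_(z <- [seq z / (s k)%:C | z <- r]) Num.max 1 (normc z)).
  have -> : L + d%:R * ln (s k) = ln (normc a * Q * s k ^+ d).
    by rewrite lnM ?posrE ?mulr_gt0 ?exprn_gt0// lnXn// mulr_natl.
  rewrite ler_ln ?posrE ?mulr_gt0 ?exprn_gt0//; last 2 first.
  - by rewrite normc_gt0.
  - by apply: prodr_gt0_seq => z _; rewrite lt_max ltr01.
  rewrite normcM normcX normc_real gtr0_norm// mulrAC ler_pM2l ?mulr_gt0
    ?exprn_gt0//.
  rewrite big_map; apply: ler_prod_seq => z _; rewrite le_max ler01 /=.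
  rewrite ge_max !le_max lexx /= normcM normcV normc_real gtr0_norm//.
  apply/orP; right; rewrite ler_pdivlMr// ler_piMr ?normc_ge0//.
  by case/andP: (sP k) => _ /ltW.
(* A bound for [|p|] on the closed disc, positive so that [ln C] is meaningful. It makes the
   functions [f k] nonnegative, as Fatou's lemma requires. *)
pose C := 1 + \sum_(j < size p) normc p`_j.
have C0 : 0 < C by rewrite ltr_pwDl// sumr_ge0// => j _; exact: normc_ge0.
have pC k t : normc p.[(s k)%:C * circ t] <= C.
  rewrite horner_coef; apply: le_trans (normc_sum_le _ _ _) _.
  rewrite /C -[leLHS]add0r lerD//; apply: ler_sum => j _.
  rewrite normcM ler_piMr ?normc_ge0// normcX normcM normc_cis mulr1 normc_real
    gtr0_norm//.
  by rewrite exprn_ile1//; [exact: ltW|case/andP: (sP k) => _ /ltW].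
have q_pos k t : 0 < normc (q k).[circ t].
  rewrite normc_gt0 /q hornerZ mulf_neq0// horner_prod prodf_seq_neq0.
  apply/allP => z zr /=; rewrite !hornerE subr_eq0.
  by apply: contraNneq (q_root1 k z zr) => <-; rewrite normc_cis.
have cq k : continuous (fun t : R => ln (normc (q k).[circ t])).
  move=> t; apply: continuous_comp (@continuous_normc_circ R (q k) t) _.
  exact: continuous_ln.
pose f k t : \bar R := (ln C - ln (normc (q k).[circ t]))%:E.
have f0 k t : (0 <= f k t)%E.
  by rewrite lee_fin subr_ge0 ler_ln ?posrE// qE pC.
have mf k : measurable_fun [set: R] (f k).
  apply/measurable_EFinP; apply: measurable_funB => //.
  exact: continuous_measurable_fun.
have intf k : (\int[mu]_(t in `[0%R, 1%R]) f k t <= (ln C - (L + d%:R * ln (s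
  k)))%:E)%E.
  rewrite /f; under eq_integral do rewrite EFinB.
  rewrite integralB_EFin//=; last 2 first.
  - by apply: (@integrable_unit_itv (cst (ln C))) => t; exact: cvg_cst.
  - exact: integrable_unit_itv.
  rewrite integral_unit_cst EFinB; apply: leeB => //.
  by apply: le_trans (qJ k); rewrite lee_fin qL.
pose h t : \bar R := ((ln C)%:E - log_circ p t)%E.
have fh t : f ^~ t @ \oo --> h t.
  have yk : normc (q k).[circ t] @[k --> \oo] --> normc p.[circ t].
    under eq_fun do rewrite qE pE.
    by rewrite pE; apply: cvg_prod_dist => //; rewrite normc_cis.
  rewrite /h /log_circ; have := normc_ge0 p.[circ t];
    rewrite le_eqVlt => /predU1P[y0|y0].
    (* At a zero of [p] the limit [h t] is [+oo]: once [|q k|] is below [expR (ln C - A)], [f k t]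
       exceeds [A]. *)
    rewrite -y0 /= lexx /=; apply/cvgeyPge => A.
    rewrite -y0 in yk; have := expR_gt0 (ln C - A).
    move=> /(cvgr_lt _ yk); apply: filterS => k yA.
    rewrite lee_fin lerBrDl -lerBrDr -ler_expR lnK ?posrE//.
    exact: ltW.
  rewrite lne_EFin// -EFinB; apply: cvg_EFin.
    by apply: nearW.
  apply: cvgB; first exact: cvg_cst.
  apply: (cvg_comp _ _ yk); exact: continuous_ln.
have mh : measurable_fun [set: R] h.
  by apply: emeasurable_funB; [exact: measurable_cst|exact:
    measurable_log_circ].
have h0 t : (0 <= h t)%E.
  rewrite -(cvg_lim _ (fh t))//; apply: lime_ge; last exact: nearW.
  by apply/cvg_ex; exists (h t); exact: fh.
have ih : (\int[mu]_(t in `[0%R, 1%R]) h t <= (ln C - L)%:E)%E.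
  have -> : (\int[mu]_(t in `[0%R, 1%R]) h t = \int[mu]_(t in `[0%R, 1%R])
    limn_einf (f^~ t))%E.
    by apply: eq_integral => t _; rewrite (cvg_limn_einf_sup (fh t)).
  apply: le_trans (fatou _ _ _ _) _ => //.
  - by move=> k; apply: measurable_funTS; exact: mf.
  apply: (limn_einf_le_lim intf); apply: cvg_EFin; first exact: nearW.
  apply: cvgB; first exact: cvg_cst.
  rewrite -[X in _ --> X]addr0 -[X in _ + X](mulr0 d%:R) -[X in _ * X](@ln1 R).
  apply: cvgD; first exact: cvg_cst.
  apply: cvgM; first exact: cvg_cst.
  apply: (cvg_comp _ _ s_cvg); exact: continuous_ln.
have inth : mu.-integrable `[0%R, 1%R] h.
  apply/integrableP; split; first exact: measurable_funTS.
  under eq_integral do rewrite gee0_abs//.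
  by apply: le_lt_trans ih _; rewrite ltry.
have logE t : log_circ p t = ((ln C)%:E - h t)%E.
  rewrite /h; case: (log_circ p t) (h0 t) => [x||] //= _.
  by rewrite -!EFinB; congr EFin; ring.
have ic : mu.-integrable `[0%R, 1%R] (fun _ : R => (ln C)%:E).
  by apply: (@integrable_unit_itv (cst (ln C))) => t; exact: cvg_cst.
have -> : log_circ p = (fun t => (ln C)%:E - h t)%E by apply/funext.
split; first exact: integrableB.
rewrite integralB// integral_unit_cst.
have hfin : (\int[mu]_(t in `[0%R, 1%R]) h t)%E \is a fin_num
  by exact: integrable_fin_num.
by move: ih; rewrite -(fineK hfin) -EFinB !lee_fin => ih;
  rewrite lerBrDl -lerBrDr.
Qed.

End JensenFull.

(** * Trigonometric bounds and polar form *)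

Section Trigo.
Local Open Scope complex_scope.
Variable R : realType.
Implicit Types (x t : R).

Lemma sin_le x : 0 <= x -> sin x <= x.
Proof.
rewrite le_eqVlt => /predU1P[<-|x0]; first by rewrite sin0.
have [|c _] := @MVT R sin cos 0 x x0 (fun c _ => is_derive_sin c).
  by apply: continuous_subspaceT => y; exact: continuous_sin.
by rewrite sin0 !subr0 => ->; apply: ler_piMl; [exact: ltW|exact: cos_le1].
Qed.

(** By the mean value theorem it suffices that [cos c >= 1/2], which follows from [cos (2c) >= 0],
    that is, [2 (cos c)^2 >= 1]. *)
Lemma sin_ge_half x : 0 <= x <= pi / 4 -> x / 2 <= sin x.
Proof.
case/andP; rewrite le_eqVlt => /predU1P[<- _|x0 x4]; first
  by rewrite sin0 mul0r.
have pi0 := pi_gt0 R.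
have [|c /[!in_itv]/= /andP[c0 cx]] := @MVT R sin cos 0 x x0 (fun c _ =>
  is_derive_sin c).
  by apply: continuous_subspaceT => y; exact: continuous_sin.
rewrite sin0 !subr0 => ->; rewrite mulrC ler_pM2r//.
have cc : 0 < cos c by apply: cos_gt0_pihalf; lra.
have c2 : 0 <= cos (c *+ 2) by apply: cos_ge0_pihalf; lra.
by move: c2; rewrite cos_mulr2n; nra.
Qed.

Lemma sin_ge_mid x t : 0 <= t <= pi / 2 -> t <= x <= pi - t -> sin t <= sin x.
Proof.
move=> t0 xt; have pi0 := pi_gt0 R.
have mono u v : - (pi / 2) <= u -> u <= v -> v <= pi / 2 -> sin u <= sin v.
  move=> ul; rewrite le_eqVlt => /predU1P[->//|uv] vl; apply: ltW.
  by rewrite ltr_sin// in_itv /=; lra.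
have [xl|xl] := leP x (pi / 2); first by apply: mono; lra.
have -> : sin x = sin (pi - x)
  by rewrite sinB sinpi cospi mul0r sub0r mulN1r opprK.
by apply: mono; lra.
Qed.

(** The half angle ranges over [[0, pi)], where sines are nonnegative: it is [acos x / 2] in the
    closed upper half-plane and [pi - acos x / 2] below. *)
Lemma polar_half (z : R[i]) : exists2 t, 0 <= t < pi & z = (normc z)%:C * cis
  (2 * t).
Proof.
have pi0 := pi_gt0 R.
have [->|z0] := eqVneq z 0.
  by exists 0; [rewrite lexx pi0|rewrite (_ : normc 0 = 0) ?mul0r//;
    exact: ComplexField.Normc.normc0].
have r0 : 0 < normc z by rewrite normc_gt0.
case: z {z0} r0 => a b; set r := normc _ => r0.
have r2 : r ^+ 2 = a ^+ 2 + b ^+ 2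
  by rewrite /r /= sqr_sqrtr ?addr_ge0 ?sqr_ge0.
set x := a / r.
have x1 : x ^+ 2 <= 1.
  by rewrite /x expr_div_n ler_pdivrMr ?exprn_gt0// mul1r r2 lerDl sqr_ge0.
have x11 : -1 <= x <= 1 by rewrite -ler_norml -(@ler_sqr _ `|x| 1)// ?nnegrE//
  real_normK ?num_real// expr1n.
have sq : Num.sqrt (1 - x ^+ 2) = `|b| / r.
  have -> : 1 - x ^+ 2 = (`|b| / r) ^+ 2.
    rewrite !expr_div_n real_normK ?num_real// r2.
    have : a ^+ 2 + b ^+ 2 != 0 by rewrite -r2 gt_eqF// exprn_gt0.
    by move=> ?; field.
  by rewrite sqrtr_sqr ger0_norm// divr_ge0// ltW.
have rx : r * x = a by rewrite mulrC divfK// gt_eqF.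
have cb : a +i* b = r%:C * (x +i* (b / r)).
  have rb : r * (b / r) = b by rewrite mulrC divfK// gt_eqF.
  by apply/eqP; rewrite eq_complex /= !mul0r subr0 addr0 rx rb !eqxx.
have [b0|b0] := leP 0 b.
  exists (acos x / 2).
    by have := acos_ge0 x11; have := acos_lepi x11; lra.
  rewrite [2 * _]mulrC divfK// cb; congr (_ * _).
  by apply/eqP; rewrite eq_complex /= sin_acos// sq ger0_norm// acosK
    ?in_itv//= ?eqxx.
(* Strictness keeps [pi - acos x / 2] below [pi]; [x = 1] would force [b = 0]. *)
have x_lt1 : x < 1.
  rewrite lt_neqAle; case/andP: x11 => _ ->; rewrite andbT; apply/eqP => xe.
  by move: sq; rewrite xe expr1n subrr sqrtr0 => /esym/eqP;
    rewrite mulf_eq0 normr_eq0 invr_eq0 (lt_eqF b0) (gt_eqF r0).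
exists (pi - acos x / 2).
  have := @acos_gt0 _ x; have := acos_lepi x11; case/andP: x11 => -> _;
    rewrite x_lt1 => ? /(_ isT); lra.
rewrite cb; congr (_ * _).
have -> : 2 * (pi - acos x / 2) = - acos x + pi *+ 2 by rewrite -mulr_natl;
  field.
apply/eqP; rewrite eq_complex /= cosD2pi sinD2pi cosN sinN sin_acos// sq.
by rewrite ltr0_norm// acosK ?in_itv//= mulNr opprK ?eqxx.
Qed.

(** Reducing the half angle modulo [pi / n] amounts to moving [z] along its orbit under [ruroot n]:
    [t] locates the base point of the orbit and [m] the position of [z] on it. *)
Lemma polar_grid (n : nat) (z : R[i]) : (0 < n)%N ->
  exists2 t, 0 <= t < pi / n%:R &
  exists2 m, (m < n)%N & z = (normc z)%:C * cis (2 * (t + m%:R * (pi / n%:R))).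
Proof.
move=> n0; have nR : (0 : R) < n%:R by rewrite ltr0n.
have pi0 := pi_gt0 R; have [t /andP[t0 tpi] zE] := polar_half z.
have d0 : 0 < pi / n%:R :> R by rewrite divr_gt0.
have q0 : 0 <= t / (pi / n%:R) by rewrite divr_ge0// ltW.
have [ml mg] := andP (truncn_itv q0).
set m := Num.truncn _ in ml mg.
rewrite ler_pdivlMr// in ml; rewrite ltr_pdivrMr// in mg.
exists (t - m%:R * (pi / n%:R)).
  by rewrite subr_ge0 ml /= ltrBlDr (lt_le_trans mg)// -addn1 natrD mulrDl
    mul1r addrC.
exists m; last by rewrite subrK.
rewrite -(ltr_nat R) -(ltr_pM2r d0) (le_lt_trans ml)//.
by rewrite mulrC divfK ?gt_eqF.
Qed.

End Trigo.

(** * Gauss-Fresnel sums *)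

Section Gauss.
Local Open Scope complex_scope.
Variable R : realType.

Definition gauss_poly (n : nat) : {poly R[i]} :=
  \poly_(j < n) cis (pi * (j%:R : R) ^+ 2 / n%:R).

Definition chirp (n : nat) (z : R[i]) (l : nat) : R[i] :=
  z ^+ l * cis (pi * l%:R ^+ 2 / n%:R).

Lemma horner_gauss_poly n (z : R[i]) : (gauss_poly n).[z] = \sum_(j < n) chirp
  n z j.
Proof.
by rewrite horner_poly; apply: eq_bigr => j _; rewrite mulrC.
Qed.

Lemma normc_chirp n (z : R[i]) l : normc (chirp n z l) = normc z ^+ l.
Proof. by rewrite normcM normc_cis mulr1 normcX. Qed.

Lemma chirpS n (z : R[i]) l :
  chirp n z l.+1 = chirp n z l * (z * cis (pi * (2 * l%:R + 1) / n%:R)).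
Proof.
rewrite /chirp exprSr mulrACA -cisD; congr (_ * cis _).
by rewrite -natr1 -!mulrDl -!mulrDr; congr (_ * _ * _); ring.
Qed.

(** The phase at [l = n] is [pi * n], a multiple of [2 * pi] because [n] is even. This is where
    parity enters. *)
Lemma chirp_full n (z : R[i]) : (0 < n)%N -> ~~ odd n -> chirp n z n = z ^+ n.
Proof.
move=> n0 en; rewrite /chirp expr2 mulrA mulfK ?pnatr_eq0 -?lt0n//.
rewrite -[n in cis (_ * n%:R)](odd_double_half n) (negPf en) add0n -mul2n natrM
  mulrA [pi * 2]mulrC.
by rewrite cis2pin mulr1.
Qed.

(** By [(j + 1)^2 = j^2 + 2 j + 1], rotating the argument shifts the summation index; the sum loses
    its term 1 at index 0 and gains [z ^+ n] at index [n]. *)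
Lemma gauss_poly_shift n (z : R[i]) : (0 < n)%N -> ~~ odd n ->
  z * cis (pi / n%:R) * (gauss_poly n).[z * ruroot R n] = (gauss_poly n).[z] -
    1 + z ^+ n.
Proof.
move=> n0 en; have nR : (n%:R : R) != 0 by rewrite pnatr_eq0 -lt0n.
have E : \sum_(j < n.+1) chirp n z j = (gauss_poly n).[z] + z ^+ n.
  by rewrite big_ord_recr /= chirp_full// horner_gauss_poly.
rewrite addrAC -E big_ord_recl /= {1}/chirp expr0 expr0n mulr0 mul0r cis0 mulr1.
rewrite [1 + _]addrC addrK horner_gauss_poly mulr_sumr; apply: eq_bigr => j _.
rewrite (_ : bump 0 j = j.+1)// chirpS /chirp exprMn /ruroot cisX.
have -> : cis (pi * (2 * j%:R + 1) / n%:R) = cis (pi / n%:R) * cis (j%:R * (2 *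
  pi / n%:R)) :> R[i].
  by rewrite -cisD; congr cis; field.
ring.
Qed.

(* These weights make the functional equation of [gauss_poly] telescope; the
   orbit is constant when [z ^+ n = 1]. *)
Definition chirp_orbit (n : nat) (z : R[i]) (l : nat) : R[i] :=
  chirp n z l * (gauss_poly n).[z * ruroot R n ^+ l].

Lemma chirp_orbitS n (z : R[i]) l : (0 < n)%N -> ~~ odd n ->
  chirp_orbit n z l.+1 = chirp_orbit n z l + chirp n z l * (z ^+ n - 1).
Proof.
move=> n0 en; have nR : (n%:R : R) != 0 by rewrite pnatr_eq0 -lt0n.
rewrite /chirp_orbit -mulrDr chirpS exprSr [z * (_ * _)]mulrA -[LHS]mulrA;
  congr (_ * _).
have -> : z * cis (pi * (2 * l%:R + 1) / n%:R) = z * ruroot R n ^+ l * cis (pi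
  / n%:R).
  rewrite /ruroot cisX -[RHS]mulrA -cisD; congr (_ * cis _); field => //.
rewrite gauss_poly_shift// exprMn -exprM mulnC exprM (prim_expr_order
  (prim_ruroot _ n0)) expr1n mulr1.
by rewrite [RHS]addrA addrAC.
Qed.

Lemma chirp_orbitB n (z : R[i]) i j : (0 < n)%N -> ~~ odd n -> (i <= j)%N ->
  chirp_orbit n z j - chirp_orbit n z i = (z ^+ n - 1) * \sum_(i <= l < j)
    chirp n z l.
Proof.
move=> n0 en /subnKC <-; elim: (j - i)%N => [|k IH].
  by rewrite addn0 subrr big_geq// mulr0.
by rewrite addnS chirp_orbitS// big_nat_recr ?leq_addr//= [RHS]mulrDr -IH
  addrAC [_ * chirp _ _ _]mulrC.
Qed.

Lemma size_gauss_poly n : (size (gauss_poly n) <= n)%N.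
Proof. exact: size_poly. Qed.

Lemma normc_coef_gauss_poly n j : (j < n)%N -> normc (gauss_poly n)`_j = 1.
Proof. by move=> jn; rewrite coef_poly jn normc_cis. Qed.

Lemma gauss_parseval n (z : R[i]) :
  \sum_(m < n) normc (gauss_poly n).[z * ruroot R n ^+ m] ^+ 2 =
  n%:R * \sum_(j < n) normc z ^+ (2 * j).
Proof.
rewrite discrete_parseval ?size_gauss_poly//; congr (_ * _).
by apply: eq_bigr => j _; rewrite normc_coef_gauss_poly// expr1n mul1r.
Qed.

(** At [z = 1] the increments of [chirp_orbit] vanish, so the [n] moduli agree, and by
    [gauss_parseval] their squares add up to [n^2]. *)
Lemma gauss_modulus n l : (0 < n)%N -> ~~ odd n ->
  normc (gauss_poly n).[ruroot R n ^+ l] ^+ 2 = n%:R.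
Proof.
move=> n0 en; have nR : (0 : R) < n%:R by rewrite ltr0n.
have step k : normc (gauss_poly n).[ruroot R n ^+ k] = normc (gauss_poly n).[1].
  have -> : normc (gauss_poly n).[ruroot R n ^+ k] = normc (chirp_orbit n 1 k).
    by rewrite normcM normc_chirp mul1r ComplexField.Normc.normc1 expr1n mul1r.
  elim: k => [|k IH]; last by rewrite chirp_orbitS// expr1n subrr mulr0 addr0.
  by rewrite normcM normc_chirp mul1r ComplexField.Normc.normc1 expr1n mul1r
    expr0.
have := gauss_parseval n 1; rewrite ComplexField.Normc.normc1.
under eq_bigr do rewrite mul1r step.
under [in RHS]eq_bigr do rewrite expr1n.
rewrite !sumr_const card_ord step -[_ *+ n]mulr_natl => /mulfI -> //.
by rewrite gt_eqF.
Qed.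

End Gauss.

(** * Abel summation of quadratic phases *)

Section AbelSum.
Local Open Scope complex_scope.
Variable R : realType.

Lemma cot_bound (x s : R) : 0 < s -> s <= sin x -> `|cos x / sin x| <= s^-1.
Proof.
move=> s0 sx; have sx0 : 0 < sin x by exact: lt_le_trans sx.
rewrite normrM normfV (gtr0_norm sx0) ler_pdivrMr// mulrC ler_pdivlMr//.
by apply: le_trans sx; apply: ler_piMl; [exact: ltW|exact: cos_max].
Qed.

Lemma normc_cisB1_ge (r a s : R) : 4^-1 <= r -> 0 < s -> s <= sin a ->
  s <= normc (r%:C * cis (2 * a) - 1).
Proof.
move=> r4 s0 sa; rewrite -(@ler_sqr _ s) ?nnegrE ?normc_ge0 ?(ltW s0)//
  normc_cisB1_sqr.
have : s ^+ 2 <= sin a ^+ 2 by rewrite ler_sqr// nnegrE ?(ltW s0)// ltW//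
  (lt_le_trans s0).
by have := sqr_ge0 (r - 1); have := sqr_ge0 (sin a); nra.
Qed.

(** Drop [(r - 1)^2] from both factors. The product of sines is the denominator of a difference of
    cotangents, against which it cancels in [phase_sum_le]. *)
Lemma normc_cisB1_mul_ge (r a b : R) : 0 <= r -> 0 <= sin a -> 0 <= sin b ->
  4 * r * (sin a * sin b) <=
  normc (r%:C * cis (2 * a) - 1) * normc (r%:C * cis (2 * b) - 1).
Proof.
move=> r0 a0 b0.
rewrite -ler_sqr ?nnegrE ?mulr_ge0 ?normc_ge0// [leRHS]exprMn !normc_cisB1_sqr.
have -> : (4 * r * (sin a * sin b)) ^+ 2 = (4 * r * sin a ^+ 2) * (4 * r * sin
  b ^+ 2) by ring.
by apply: ler_pM; rewrite ?mulr_ge0 ?sqr_ge0// lerDr sqr_ge0.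
Qed.

(* Abel summation of [w l = (w l.+1 - w l) / (xi l - 1)], where
   [xi l = r cis (2 a l)]; the variation of [(xi l - 1)^-1] is at most half that
   of [cot (a l)], which is monotone. *)
Lemma phase_sum_le (w : nat -> R[i]) (a : nat -> R) (r e s W : R) (k : nat) :
  4^-1 <= r -> 0 <= sin e -> 0 < s ->
  (forall l, (l <= k)%N -> w l.+1 = w l * (r%:C * cis (2 * a l))) ->
  (forall l, (l <= k.+1)%N -> normc (w l) <= W) ->
  (forall l, (l < k)%N -> a l.+1 = a l + e) ->
  (forall l, (l <= k)%N -> s <= sin (a l)) ->
  normc (\sum_(0 <= l < k.+1) w l) <= 3 * W / s.
Proof.
move=> r4 e0 s0 wS wW aS sa.
have r0 : 0 < r by lra.
have W0 : 0 <= W by apply: le_trans (wW 0%N isT); exact: normc_ge0.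
pose xi l := r%:C * cis (2 * a l) : R[i].
pose g l := (xi l - 1)^-1.
have sin0 l : (l <= k)%N -> 0 < sin (a l) by move=> lk;
  apply: lt_le_trans (sa l lk).
have xi1 l : (l <= k)%N -> s <= normc (xi l - 1) by move=> lk;
  apply: normc_cisB1_ge => //; exact: sa.
have xi0 l : (l <= k)%N -> xi l - 1 != 0.
  by move=> lk; rewrite -normc_gt0; apply: lt_le_trans (xi1 l lk).
have gs l : (l <= k)%N -> normc (g l) <= s^-1.
  by move=> lk; rewrite normcV lef_pV2 ?posrE ?normc_gt0 ?xi0// xi1.
have xig l : (l <= k)%N -> xi l * g l = 1 + g l.
  by move=> lk; rewrite -{1}[xi l](subrK 1) mulrDl mulfV ?xi0// mul1r.
pose cot x : R := cos x / sin x.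
(* Once the boundary term [w j.+1 * g j] is removed, each further index costs at most [W / 2] times
   the drop of the cotangent, so the costs telescope. *)
have main j : (j <= k)%N -> normc (\sum_(0 <= l < j.+1) w l - w j.+1 * g j) <=
    W * (s^-1 + 2^-1 * (cot (a 0%N) - cot (a j))).
  elim: j => [_|j IH jk].
    rewrite big_nat1 wS// subrr mulr0 addr0 -/(xi 0%N).
    rewrite -mulrA xig// mulrDr mulr1 opprD addrA subrr add0r.
    by rewrite normcN normcM ler_pM ?normc_ge0 ?wW ?gs.
  have jk' := ltnW jk.
  rewrite big_nat_recr//=.
  have -> : \sum_(0 <= l < j.+1) w l + w j.+1 - w j.+2 * g j.+1 =
     (\sum_(0 <= l < j.+1) w l - w j.+1 * g j) + w j.+1 * (g j - g j.+1).
    by rewrite (wS j.+1)// -/(xi j.+1) -[w j.+1 * xi j.+1 * _]mulrA xig//; ring.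
  apply: le_trans (normcD_le _ _) _.
  have -> : W * (s^-1 + 2^-1 * (cot (a 0%N) - cot (a j.+1))) =
    W * (s^-1 + 2^-1 * (cot (a 0%N) - cot (a j))) + W * (2^-1 * (cot (a j) -
      cot (a j.+1))) by ring.
  apply: lerD; first exact: IH.
  rewrite normcM ler_pM ?normc_ge0 ?wW// ?(ltnW (ltnW _))//.
  have -> : g j - g j.+1 = r%:C * cis (2 * a j) * (cis (2 * e) - 1) * ((xi j -
    1) * (xi j.+1 - 1))^-1.
    rewrite invfM -/(g j) -/(g j.+1).
    have -> : r%:C * cis (2 * a j) * (cis (2 * e) - 1) = xi j.+1 - xi j.
      by rewrite /xi aS// (mulrDr 2) cisD; ring.
    have -> : xi j.+1 - xi j = (xi j.+1 - 1) - (xi j - 1) by ring.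
    rewrite mulrBl mulrCA mulfV ?xi0// mulr1 [_ * (g j * _)]mulrA mulfV ?xi0//
      mul1r//.
  rewrite !normcM normcV normcM normc_real normc_cis mulr1 normc_cisB1
    !ger0_norm// ?(ltW r0)//.
  have -> : cot (a j) - cot (a j.+1) = sin e / (sin (a j) * sin (a j.+1)).
    have -> : sin e = sin (a j.+1 - a j) by rewrite aS// addrC addKr.
    by rewrite /cot sinB; field; rewrite !gt_eqF ?sin0.
  rewrite ler_pdivrMr ?mulr_gt0 ?normc_gt0 ?xi0//.
  have := @normc_cisB1_mul_ge r (a j) (a j.+1) (ltW r0) (ltW (sin0 j jk')) (ltW
    (sin0 _ jk)).
  rewrite -/(xi j) -/(xi j.+1); set P := normc _ * normc _ => hP.
  have ss : 0 < sin (a j) * sin (a j.+1) by rewrite mulr_gt0 ?sin0.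
  have -> : r * (2 * sin e) = (2^-1 * (sin e / (sin (a j) * sin (a j.+1)))) *
    (4 * r * (sin (a j) * sin (a j.+1))).
    by field; rewrite !gt_eqF ?sin0.
  by rewrite ler_wpM2l// !mulr_ge0// invr_ge0 ltW.
(* The three contributions [W / s] are the boundary term at each end and half of the total drop of
   the cotangent, which is at most [2 / s]. *)
rewrite -(subrK (w k.+1 * g k) (\sum_(0 <= l < k.+1) w l)).
apply: le_trans (normcD_le _ _) _.
have c1 : cot (a 0%N) <= s^-1 by apply: le_trans (ler_norm _) _;
  apply: cot_bound => //; exact: sa.
have c2 : - cot (a k) <= s^-1 by apply: le_trans (ler_norm _) _;
  rewrite normrN; apply: cot_bound => //; exact: sa.
have := main k (leqnn k).
have : normc (w k.+1 * g k) <= W * s^-1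
  by rewrite normcM ler_pM ?normc_ge0 ?wW ?gs.
have : W * (cot (a 0%N) - cot (a k)) <= W * (2 * s^-1)
  by rewrite ler_wpM2l//; lra.
move: (cot _ - cot _) (normc _) (normc _) => x b c; rewrite -[3 * W / s]mulrA.
by move: (s^-1) => v; nra.
Qed.

End AbelSum.

(** * Location of the zeros *)

Section ZeroLocation.
Local Open Scope complex_scope.
Variable R : realType.

Lemma bernoulli_ge (x : R) n : 0 <= x -> 1 + n%:R * (x - 1) <= x ^+ n.
Proof.
move=> x0; elim: n => [|n IH]; first by rewrite mul0r addr0 expr0.
rewrite exprS; apply: le_trans (ler_wpM2l x0 IH).
have n0 : (0 : R) <= n%:R by []; rewrite -natr1.
have := mulr_ge0 n0 (sqr_ge0 (x - 1)).
nra.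
Qed.

(** Bernoulli's inequality for [r] gives the upper bound; for [r^-1] it gives the lower one, through
    [1 / (1 + d) >= 1 - d]. *)
Lemma root_near_one (r B : R) n : (0 < n)%N -> 0 <= B -> 0 < r -> B^-1 <= r ^+
  n <= B ->
  1 - B / n%:R <= r <= 1 + B / n%:R.
Proof.
move=> n0 B0 r0 /andP[rl rg]; have nR : (0 : R) < n%:R by rewrite ltr0n.
have key x : 0 <= x -> x ^+ n <= B -> x <= 1 + B / n%:R.
  move=> x0 xB; have := le_trans (bernoulli_ge n x0) xB.
  by rewrite -lerBlDl ler_pdivlMr// mulrC; lra.
rewrite (key r) ?(ltW r0)// andbT.
have Bp : 0 < B by apply: lt_le_trans rg; rewrite exprn_gt0.
have : r^-1 <= 1 + B / n%:R.
  apply: key; first by rewrite invr_ge0 ltW.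
  by rewrite exprVn -[B]invrK lef_pV2// posrE ?exprn_gt0// invr_gt0.
have d0 : 0 < B / n%:R by rewrite divr_gt0.
move: (B / n%:R) d0 => d d0 rd.
have : r * r^-1 <= r * (1 + d) by rewrite ler_pM2l.
rewrite mulfV ?gt_eqF//.
nra.
Qed.

(** The half angles of successive ratios form an arithmetic progression of step [pi / n], as
    [phase_sum_le] requires. *)
Lemma chirp_step n (r t : R) l : (0 < n)%N ->
  chirp n (r%:C * cis (2 * t)) l.+1 = chirp n (r%:C * cis (2 * t)) l *
   (r%:C * cis (2 * (t + l%:R * (pi / n%:R) + pi / (2 * n%:R)))).
Proof.
move=> n0; have nR : (n%:R : R) != 0 by rewrite pnatr_eq0 -lt0n.
by rewrite chirpS -mulrA -cisD; congr (_ * (_ * cis _)); field.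
Qed.

(** At indices in [[h, n - h)] the half angles keep a distance at least [h * pi / n] from 0 and
    [pi], so their sines are at least [h / n]. This is the [s] of [phase_sum_le]; [4 * h <= n]
    brings [sin_ge_half] within range. *)
Lemma chirp_window n h (r t W : R) i j : (0 < h)%N -> (4 * h <= n)%N -> 4^-1 <=
  r ->
  0 <= t < pi / n%:R ->
  (forall l, (l <= n)%N -> normc (chirp n (r%:C * cis (2 * t)) l) <= W) ->
  (h <= i)%N -> (i <= j)%N -> (j < n - h)%N ->
  normc (\sum_(i <= l < j) chirp n (r%:C * cis (2 * t)) l) <= 3 * W * (n%:R /
    h%:R).
Proof.
move=> h0 hn r4 /andP[t0 tn] wW hi; set z0 := _ * _ in wW *.
have n0 : (0 < n)%N by lia.
have nR : (0 : R) < n%:R by rewrite ltr0n.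
have hR : (0 : R) < h%:R by rewrite ltr0n.
have W0 : 0 <= W by apply: le_trans (wW 0%N isT); exact: normc_ge0.
rewrite leq_eqVlt => /predU1P[<- _|ij jn].
  by rewrite big_geq// (ComplexField.Normc.normc0) !mulr_ge0// divr_ge0.
have pi0 := pi_gt0 R.
set d := pi / n%:R in tn.
have d0 : 0 < d by rewrite divr_gt0.
have dn : n%:R * d = pi by rewrite /d mulrC divfK// gt_eqF.
rewrite -(add0n i) big_addn.
have -> : (j - i)%N = (j - i).-1.+1 by rewrite prednK// subn_gt0.
set k := (j - i).-1.
have kj : (k + i < j)%N by rewrite /k; lia.
have -> : 3 * W * (n%:R / h%:R) = 3 * W / (h%:R / n%:R) by rewrite invf_div.
pose a l := t + (l + i)%:R * d + pi / (2 * n%:R).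
have half : pi / (2 * n%:R) = d / 2 by rewrite /d; field; rewrite gt_eqF.
have hd4 : h%:R * d <= pi / 4.
  have : (4 * h)%:R <= n%:R :> R by rewrite ler_nat.
  by rewrite natrM -dn => ?; nra.
apply: (@phase_sum_le _ _ a r d) => //.
- by apply/sin_ge0_pi; rewrite ltW//= -dn ler_peMl ?ler1n// ltW.
- by rewrite divr_gt0.
- by move=> l lk; rewrite addSn chirp_step.
- by move=> l lk; apply: wW; lia.
- by move=> l lk; rewrite /a addSn -natr1; ring.
- move=> l lk; rewrite /a half.
  have li : (h%:R : R) <= (l + i)%:R by rewrite ler_nat; lia.
  (* The spare 2 absorbs the offset [t < d] and the half step [d / 2]. *)
  have lj : ((l + i + h + 2)%:R : R) <= n%:R by rewrite ler_nat; lia.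
  apply: (@le_trans _ _ (h%:R * d / 2)).
    have -> : h%:R * d / 2 = (h%:R / n%:R) * (pi / 2) by rewrite /d; field;
      rewrite gt_eqF.
    by apply: ler_peMr; [rewrite divr_ge0|have := pi_ge2 R; lra].
  apply: (@le_trans _ _ (sin (h%:R * d))).
    by apply: sin_ge_half; rewrite hd4 mulr_ge0// ltW.
  apply: sin_ge_mid; first by rewrite mulr_ge0 ?(ltW d0)//=; lra.
  rewrite -dn; move: lj li; rewrite !natrD => lj li; apply/andP; split; nra.
Qed.

Lemma exprn_between (r B : R) n l : 0 < r -> 1 <= B -> B^-1 <= r ^+ n <= B ->
  (l <= n)%N ->
  B^-1 <= r ^+ l <= B.
Proof.
move=> r0 B1 /andP[rl rg] ln; have BV : B^-1 <= 1
  by rewrite invf_le1// (lt_le_trans _ B1).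
have [r1|r1] := leP r 1.
  rewrite (le_trans rl); last by rewrite ler_wiXn2l// ltW.
  by rewrite (le_trans _ B1)// exprn_ile1// ltW.
rewrite (le_trans BV); last by rewrite exprn_ege1// ltW.
by rewrite (le_trans _ rg)//; apply: ler_weXn2l => //; apply: ltW.
Qed.

Lemma normc_near_one (r t : R) : normc (r%:C * cis (2 * t) - 1) <= `|r - 1| + 2
  * `|sin t|.
Proof.
have -> : r%:C * cis (2 * t) - 1 = (r - 1)%:C * cis (2 * t) + (cis (2 * t) - 1).
  by rewrite rmorphB /=; ring.
apply: le_trans (normcD_le _ _) _.
by rewrite normcM normc_cis mulr1 normc_real normc_cisB1.
Qed.

(** At these positions the half angle is within [h * pi / n] of 0 or of [pi]. The constant is
    [9 = 1 + 2 * 4]: 1 for [|r - 1| <= B / n <= h / n], and 4 from [pi < 4] for the sine, which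
    counts twice. *)
Lemma gauss_grid_near_one (n h : nat) (B r t : R) (m : nat) :
  (4 * h <= n)%N -> (0 < n)%N -> 1 <= B <= h%:R -> 0 < r -> B^-1 <= r ^+ n <= B
    ->
  0 <= t < pi / n%:R -> (m < n)%N -> (m < h)%N || (n - h <= m)%N ->
  normc (r%:C * cis (2 * (t + m%:R * (pi / n%:R))) - 1) <= 9 * (h%:R / n%:R).
Proof.
move=> hn n0 /andP[B1 Bh] r0 rB /andP[t0 tn] mn mh.
have nR : (0 : R) < n%:R by rewrite ltr0n.
have B0 : 0 < B by apply: lt_le_trans B1.
have hR : (0 : R) < h%:R by apply: lt_le_trans Bh.
have /andP[rl ru] := root_near_one n0 (ltW B0) r0 rB.
have Bhn : B / n%:R <= h%:R / n%:R by rewrite ler_pM2r ?invr_gt0.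
have hn4 : h%:R / n%:R <= 4^-1 :> R.
  have : (4 * h)%:R <= n%:R :> R by rewrite ler_nat.
  by rewrite natrM ler_pdivrMr//; lra.
have pi2 := pi_ge2 R; have pi4 : pi < 4 :> R by have := pihalf_lt2 R; lra.
have pi0 := pi_gt0 R.
set d := pi / n%:R in tn *.
have d0 : 0 < d by rewrite divr_gt0.
have dn : n%:R * d = pi by rewrite /d mulrC divfK// gt_eqF.
have hd : h%:R * d <= 4 * (h%:R / n%:R).
  have -> : h%:R * d = pi * (h%:R / n%:R) by rewrite /d; field; rewrite gt_eqF.
  by rewrite ler_pM2r ?divr_gt0// ltW.
have rr : `|r - 1| <= h%:R / n%:R by rewrite ler_norml; lra.
clear rB.
have near x : 0 <= x <= h%:R * d -> `|r - 1| + 2 * `|sin x| <= 9 * (h%:R /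
  n%:R).
  case/andP=> x0 xh; have sx : sin x <= x := sin_le x0.
  have s0 : 0 <= sin x by apply: sin_ge0_pi; rewrite x0 /=; lra.
  by rewrite (ger0_norm s0); lra.
apply: le_trans (normc_near_one _ _) _.
case/orP: mh => mh.
  apply: near; apply/andP; split; first by rewrite addr_ge0// mulr_ge0// ltW.
  have : (m.+1)%:R * d <= h%:R * d by rewrite ler_pM2r// ler_nat.
  rewrite -natr1 mulrDl mul1r => A.
  by rewrite (le_trans _ A)// addrC lerD2l ltW.
have -> : sin (t + m%:R * d) = sin (pi - (t + m%:R * d)).
  by rewrite sinB sinpi cospi mul0r sub0r mulN1r opprK.
apply: near; rewrite -dn.
have A : (m.+1)%:R * d <= n%:R * d by rewrite ler_pM2r// ler_nat.
have : n%:R * d <= (m + h)%:R * d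
  by rewrite ler_pM2r// ler_nat addnC -leq_subLR.
rewrite natrD mulrDl => C; rewrite -natr1 mulrDl mul1r in A.
rewrite subr_ge0 (le_trans _ A) ?[t + _]addrC ?lerD2l ?(ltW tn)//=.
by rewrite opprD addrA lerBlDr lerBlDl (le_trans C)// lerD2l lerDl.
Qed.

(* [D] bounds the orbit at the indices in [[h, n - h)], and [D + 2 B^2 h] at the
   other [2 h] ones. *)
Lemma gauss_middle_zero (n h : nat) (B r t D : R) (m : nat) :
  (0 < h)%N -> (4 * h <= n)%N -> ~~ odd n -> 1 <= B <= h%:R ->
  0 < r -> B^-1 <= r ^+ n <= B -> 0 <= t < pi / n%:R -> (h <= m < n - h)%N ->
  (gauss_poly R n).[r%:C * cis (2 * (t + m%:R * (pi / n%:R)))] = 0 ->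
  D = 6 * B ^+ 2 * (n%:R / h%:R) ->
  n%:R ^+ 2 <= B ^+ 4 * (n%:R * D ^+ 2 + 2 * h%:R * (D + 2 * B ^+ 2 * h%:R) ^+
    2).
Proof.
move=> h0 hn.
have n0 : (0 < n)%N by lia.
have hn1 : (h < n - h)%N by lia.
have hn2 : (h <= n)%N by lia.
have hn3 : (h <= (n - h).-1 < n - h)%N by lia.
have hn4 l : (l < n)%N -> (n - h <= l)%N -> ((n - h).-1 <= l)%N && (l - (n -
  h).-1 <= h)%N by lia.
have hn5 : (n - (n - h) = h)%N by lia.
move=> en /andP[B1 Bh] r0 zB /andP[t0 tn] /andP[mh mnh] z0E DE.
have mn : (m < n)%N by apply: leq_trans mnh _; exact: leq_subr.
have nR : (0 : R) < n%:R by rewrite ltr0n.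
have hR : (0 : R) < h%:R by rewrite ltr0n.
have B0 : 0 < B by apply: lt_le_trans B1.
have rBl l : (l <= n)%N -> B^-1 <= r ^+ l <= B by exact: exprn_between.
have r4 : 4^-1 <= r.
  have /andP[rl _] := root_near_one n0 (ltW B0) r0 zB.
  have Bhn : B / n%:R <= h%:R / n%:R by rewrite ler_pM2r ?invr_gt0.
  have hn4' : h%:R / n%:R <= 4^-1 :> R.
    have : (4 * h)%:R <= n%:R :> R by rewrite ler_nat.
    by rewrite natrM ler_pdivrMr//; lra.
  by clear DE z0E zB; lra.
pose z0 : R[i] := r%:C * cis (2 * t).
have z0r : normc z0 = r by rewrite normcM normc_cis mulr1 normc_real gtr0_norm.
have zm : r%:C * cis (2 * (t + m%:R * (pi / n%:R))) = z0 * ruroot R n ^+ m.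
  rewrite /z0 /ruroot cisX -mulrA -cisD; congr (_ * cis _).
  by field; rewrite gt_eqF.
rewrite zm in z0E.
pose T l := chirp_orbit n z0 l.
have Tm : T m = 0 by rewrite /T /chirp_orbit z0E mulr0.
have wB l : (l <= n)%N -> normc (chirp n z0 l) <= B.
  by move=> ln; rewrite normc_chirp z0r; case/andP: (rBl l ln).
have zn1 : normc (z0 ^+ n - 1) <= 2 * B.
  apply: le_trans (normcD_le _ _) _;
    rewrite normcN ComplexField.Normc.normc1 normcX z0r.
  by case/andP: zB => _ rB; rewrite mulr_natl mulr2n addrC lerD.
have TB i j : (i <= j)%N -> normc (T j - T i) <= 2 * B * normc (\sum_(i <= l <
  j) chirp n z0 l).
  by move=> ij; rewrite /T chirp_orbitB// normcM ler_wpM2r// normc_ge0.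
(* [D] is the bound [2 * B] for [|z0^n - 1|] times the Abel bound [3 * B * n / h]. *)
have Twin i j : (h <= i)%N -> (i <= j)%N -> (j < n - h)%N -> normc (T j - T i)
  <= D.
  move=> hi ij jn; apply: le_trans (TB i j ij) _.
  have -> : D = 2 * B * (3 * B * (n%:R / h%:R)) by rewrite DE; ring.
  apply: ler_wpM2l; first by rewrite mulr_ge0// ltW.
  by apply: chirp_window => //; rewrite t0.
(* Near the ends Abel summation gives nothing, and each term is merely bounded by [B]. *)
have Tcr i j : (i <= j)%N -> (j <= n)%N -> normc (T j - T i) <= 2 * B ^+ 2 * (j
  - i)%:R.
  move=> ij jn; apply: le_trans (TB i j ij) _.
  have -> : 2 * B ^+ 2 * (j - i)%:R = 2 * B * (B * (j - i)%:R) by ring.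
  apply: ler_wpM2l; first by rewrite mulr_ge0// ltW.
  apply: le_trans (normc_sum_le _ _ _) _.
  rewrite mulr_natr -sumr_const_nat; apply: ler_sum_nat => l /andP[_ lj].
  by apply: wB; exact: ltnW (leq_trans lj jn).
have Tgood l : (h <= l < n - h)%N -> normc (T l) <= D.
  case/andP=> hl ln; have [lm|ml] := leqP l m.
    by have := Twin l m hl lm mnh; rewrite Tm sub0r normcN.
  by have := Twin m l mh (ltnW ml) ln; rewrite Tm subr0.
set E := D + _.
have Tall l : (l < n)%N -> normc (T l) <= E.
  move=> ln; have c0 : 0 <= 2 * B ^+ 2 by rewrite mulr_ge0// sqr_ge0.
  have [lh|lh] := ltnP l h.
    have h1 : normc (T h) <= D by apply: Tgood; rewrite leqnn.
    have h2 := Tcr l h (ltnW lh) hn2.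
    have -> : T l = T h - (T h - T l) by ring.
    apply: le_trans (normcD_le _ _) _; rewrite normcN; apply: lerD => //.
    by apply: le_trans h2 _; rewrite ler_wpM2l// ler_nat leq_subr.
  have [lnh|lnh] := ltnP l (n - h).
    apply: le_trans (Tgood l _) _; first by rewrite lh.
    by rewrite lerDl mulr_ge0.
  have h1 := Tgood _ hn3; have /andP[nl ll] := hn4 _ ln lnh.
  have h2 := Tcr _ l nl (ltnW ln).
  have -> : T l = T (n - h).-1 + (T l - T (n - h).-1) by ring.
  apply: le_trans (normcD_le _ _) _; apply: lerD => //.
  by apply: le_trans h2 _; rewrite ler_wpM2l// ler_nat.
have D0 : 0 <= D by apply: le_trans (Tgood m _); rewrite ?normc_ge0// mh.
have E0 : 0 <= E by rewrite /E addr_ge0// mulr_ge0// mulr_ge0// sqr_ge0.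
(* Passing from the orbit back to the polynomial divides by a weight of modulus [r ^+ l >= B^-1]. *)
have QT l : (l <= n)%N -> normc (gauss_poly R n).[z0 * ruroot R n ^+ l] <= B *
  normc (T l).
  move=> ln; rewrite /T /chirp_orbit normcM normc_chirp z0r mulrA ler_peMl
    ?normc_ge0//.
  by case/andP: (rBl l ln) => + _; rewrite -[B * _]mulrC -ler_pdivrMr// mul1r.
have par := gauss_parseval n z0.
(* In Parseval's identity every [|z0|^(2j)] is at least [B^-2], so the sum over the orbit cannot be
   small. *)
have lo : n%:R * (n%:R * (B^-1) ^+ 2) <= n%:R * \sum_(j < n) normc z0 ^+ (2 *
  j).
  rewrite ler_wpM2l// mulr_natl -[X in _ *+ X]card_ord -sumr_const;
    apply: ler_sum => j _.
  rewrite mulnC exprM z0r ler_sqr ?nnegrE ?invr_ge0 ?exprn_ge0 ?(ltW B0) ?(ltW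
    r0)//.
  by case/andP: (rBl j (ltnW (ltn_ord j))).
rewrite -par in lo.
have hi : \sum_(m < n) normc (gauss_poly R n).[z0 * ruroot R n ^+ m] ^+ 2 <=
    B ^+ 2 * (n%:R * D ^+ 2 + 2 * h%:R * E ^+ 2).
  apply: (@le_trans _ _ (\sum_(0 <= l < n) B ^+ 2 * normc (T l) ^+ 2)).
    rewrite big_mkord; apply: ler_sum => l _.
    rewrite -exprMn ler_sqr ?nnegrE ?mulr_ge0 ?normc_ge0 ?(ltW B0)//.
    by apply: QT; exact: ltnW.
  rewrite -mulr_sumr ler_wpM2l ?sqr_ge0//.
  rewrite (@big_cat_nat _ _ _ h)//= (@big_cat_nat _ _ _ (n - h) h n) ?leq_subr
    ?(ltnW hn1)//=.
  have s1 : \sum_(0 <= l < h) normc (T l) ^+ 2 <= h%:R * E ^+ 2.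
    rewrite mulr_natl -[X in _ *+ X]subn0 -sumr_const_nat;
      apply: ler_sum_nat => l /andP[_ lh].
    by rewrite ler_sqr ?nnegrE ?normc_ge0// Tall// (leq_trans lh).
  have s2 : \sum_(h <= l < n - h) normc (T l) ^+ 2 <= n%:R * D ^+ 2.
    apply: (@le_trans _ _ ((n - h - h)%:R * D ^+ 2)).
      rewrite mulr_natl -sumr_const_nat; apply: ler_sum_nat => l hl.
      by rewrite ler_sqr ?nnegrE ?normc_ge0// Tgood.
    by rewrite ler_wpM2r ?sqr_ge0// ler_nat -subnDA leq_subr.
  have s3 : \sum_(n - h <= l < n) normc (T l) ^+ 2 <= h%:R * E ^+ 2.
    rewrite -{2}hn5 mulr_natl -sumr_const_nat;
      apply: ler_sum_nat => l /andP[_ ln].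
    by rewrite ler_sqr ?nnegrE ?normc_ge0// Tall.
  have -> : 2 * h%:R * E ^+ 2 = h%:R * E ^+ 2 + h%:R * E ^+ 2 by ring.
  by rewrite addrCA; apply: lerD => //; apply: lerD.
have := le_trans lo hi.
have -> : n%:R * (n%:R * B^-1 ^+ 2) = n%:R ^+ 2 / B ^+ 2 :> R
  by rewrite exprVn; ring.
rewrite ler_pdivrMr ?exprn_gt0// mulrC mulrA -exprD.
by [].
Qed.

End ZeroLocation.

(** * Zero counting and the Mahler measure *)

Section ZeroCount.
Local Open Scope complex_scope.
Variable R : realType.

Lemma horner_linprod (a : R[i]) (r : seq R[i]) (x : R[i]) :
  normc (a *: \prod_(z <- r) ('X - z%:P)).[x] = normc a * \prod_(z <- r) normc
    (x - z).
Proof.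
rewrite hornerZ normcM horner_prod normc_prod; congr (_ * _).
by apply: eq_bigr => z _; rewrite !hornerE.
Qed.

Lemma normc_nat k : normc (k%:R : R[i]) = k%:R.
Proof. by apply: complexI; rewrite normcC rmorph_nat normr_nat. Qed.

(** A finite maximum principle: the mean of [p] over more equidistant points of the circle than its
    degree is exactly [p.[c]], so the values there cannot all be smaller in modulus. *)
Lemma horner_circle_ge (p : {poly R[i]}) (c : R[i]) (s : R) :
  exists2 x, normc (x - c) = `|s| & normc p.[c] <= normc p.[x].
Proof.
pose q := p \Po (c%:P + s%:C%:P * 'X).
have qE x : q.[x] = p.[c + s%:C * x] by rewrite horner_comp !hornerE.
pose n := (size q).+1.
have := @sum_horner_ruroot R n q (leqnSn _).
have -> : q`_0 = p.[c] by rewrite -horner_coef0 qE mulr0 addr0.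
move=> S; suff [m hm] : exists m : 'I_n, normc p.[c] <= normc q.[ruroot R n ^+
  m].
  exists (c + s%:C * ruroot R n ^+ m); last by rewrite -qE.
  by rewrite addrC addKr normcM normc_real normcX normc_cis expr1n mulr1.
apply/existsP; rewrite -[X in is_true X]negbK negb_exists;
  apply/negP => /forallP h.
have : \sum_(m < n) normc q.[ruroot R n ^+ m] < \sum_(m < n) normc p.[c].
  apply: ltr_sum; first by apply/hasP; exists ord0; rewrite ?mem_index_enum.
  by move=> m _; rewrite ltNge; apply/negP => hm; have := h m; rewrite hm.
rewrite sumr_const card_ord => /(le_lt_trans (normc_sum_le _ _ _)).
have -> : normc p.[c] *+ n = normc (n%:R * p.[c]).
  by rewrite normcM -[LHS]mulr_natl; congr (_ * _); rewrite -normc_nat.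
by rewrite -S ltxx.
Qed.

(* On the circle of radius [3 s], each factor [x - z] with [z] within [s] of [c]
   is at least twice [c - z] in modulus. *)
Lemma zero_count (p : {poly R[i]}) (a : R[i]) (r : seq R[i]) (c : R[i]) (s : R)
  :
  p = a *: \prod_(z <- r) ('X - z%:P) -> 0 <= s ->
  exists2 x, normc (x - c) <= 3 * s &
    normc p.[c] * 2 ^+ count (fun z => normc (z - c) <= s) r <= normc p.[x].
Proof.
move=> -> s0; pose N z := normc (z - c) <= s.
pose far := [seq z <- r | ~~ N z].
(* The maximum principle is applied to the factors of the far zeros only; those of the near zeros
   are compared one by one. *)
have [x xc xle] := horner_circle_ge (a *: \prod_(z <- far) ('X - z%:P)) c (3 *
  s).
rewrite ger0_norm ?mulr_ge0// in xc.
exists x; first by rewrite xc.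
have split y : normc (a *: \prod_(z <- r) ('X - z%:P)).[y] =
    normc (a *: \prod_(z <- far) ('X - z%:P)).[y] * \prod_(z <- r | N z) normc
      (y - z).
  by rewrite !horner_linprod (bigID N) /= big_filter -mulrA [X in _ * X =
    _]mulrC.
rewrite !split -mulrA; apply: ler_pM => //; first exact: normc_ge0.
  by rewrite mulr_ge0 ?exprn_ge0// prodr_ge0// => z _; exact: normc_ge0.
rewrite -big_filter -[X in _ <= X]big_filter -size_filter.
elim: [seq z <- r | N z] (filter_all N r) => [_|z l IH /= /andP[zN lN]].
  by rewrite !big_nil mul1r.
rewrite !big_cons exprS mulrACA; apply: ler_pM; last exact: IH.
- by rewrite mulr_ge0// normc_ge0.
- by rewrite mulr_ge0 ?exprn_ge0// prodr_ge0// => y _; exact: normc_ge0.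
have : normc (x - c) <= normc (x - z) + normc (z - c).
  by apply: le_trans (normcD_le _ _); rewrite addrA subrK.
rewrite xc [normc (c - z)]normcB; move: zN; rewrite /N.
by move: (normc _) (normc _) => u v ? ?; lra.
Qed.

(** With [y = |z|^n], [1 + y = max(1, y) (1 + min(y, 1/y))]. The minimum is below [B^-1] outside the
    window; inside it, the factor 2, switched on by the boolean exponent, bounds the last term. *)
Lemma normc_subX_le (z : R[i]) (B : R) n : 0 < B ->
  normc (1 - z ^+ n) <= Num.max 1 (normc z) ^+ n * (1 + B^-1) *
    2 ^+ (B^-1 <= normc z ^+ n <= B)%R.
Proof.
move=> B0; have BV : 0 < B^-1 by rewrite invr_gt0.
set x := normc z; have x0 : 0 <= x := normc_ge0 z.
have mx : Num.max 1 x ^+ n = Num.max 1 (x ^+ n).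
  have [x1|x1] := leP x 1; first by rewrite expr1n max_l// exprn_ile1.
  by rewrite max_r// exprn_ege1// ltW.
rewrite mx; apply: (@le_trans _ _ (1 + x ^+ n)).
  by apply: le_trans (normcD_le _ _) _;
    rewrite normcN normcX ComplexField.Normc.normc1.
have y0 : 0 <= x ^+ n by rewrite exprn_ge0.
move: (x ^+ n) y0 => y y0.
have m1 : 1 <= Num.max 1 y by rewrite le_max lexx.
have my : y <= Num.max 1 y by rewrite le_max lexx orbT.
have [/andP[yl yg]|] := boolP (B^-1 <= y <= B).
  rewrite expr1; apply: (@le_trans _ _ (Num.max 1 y * 2)); first by lra.
  by rewrite ler_pM2r// ler_peMr; lra.
rewrite expr0 mulr1 negb_and -!ltNge => /orP[yl|yg].
  by rewrite (le_trans (_ : _ <= 1 + B^-1)) ?ler_peMl//; lra.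
rewrite mulrDr mulr1; have : 1 <= y * B^-1 by rewrite ler_pdivlMr// mul1r ltW.
have : y * B^-1 <= Num.max 1 y * B^-1 by rewrite ler_pM2r.
by lra.
Qed.

(** Exchanging the products, each zero [z] contributes [|1 - z^n|]. As [size r <= n], the factors
    [1 + B^-1] number at most [n]. *)
Lemma prod_unity_le (p : {poly R[i]}) (a : R[i]) (r : seq R[i]) (B : R) n : (0
  < n)%N -> 0 < B ->
  (size r <= n)%N ->
  p = a *: \prod_(z <- r) ('X - z%:P) ->
  \prod_(j < n) normc p.[ruroot R n ^+ j] <=
  (normc a * \prod_(z <- r) Num.max 1 (normc z)) ^+ n * (1 + B^-1) ^+ n *
    2 ^+ count (fun z => B^-1 <= normc z ^+ n <= B) r.
Proof.
move=> n0 B0 rn pE'.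
have pE x : normc p.[x] = normc a * \prod_(z <- r) normc (x - z)
  by rewrite pE' horner_linprod.
rewrite (eq_bigr (fun j : 'I_n =>
  normc a * \prod_(z <- r) normc (ruroot R n ^+ j - z)));
  last by move=> j _; exact: pE.
rewrite big_split /= prodr_const card_ord exchange_big /= exprMn -!mulrA.
apply: ler_wpM2l; first by rewrite exprn_ge0// normc_ge0.
have BV : 0 < B^-1 by rewrite invr_gt0.
have E z : \prod_(j < n) normc (ruroot R n ^+ j - z) = normc (1 - z ^+ n).
  have := normc_prod_ruroot (1 : R[i]) z n0; rewrite expr1n => <-.
  by apply: eq_bigr => j _; rewrite mul1r.
rewrite (eq_bigr (fun z => normc (1 - z ^+ n))); last by move=> z _; exact: E.
apply: (@le_trans _ _ (\prod_(z <- r) Num.max 1 (normc z) ^+ n * (1 + B^-1) ^+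
  size r *
    2 ^+ count (fun z => B^-1 <= normc z ^+ n <= B) r)).
  elim: r {rn pE pE'} => [|z r IH]; first by rewrite !big_nil !expr0 !mulr1.
  rewrite !big_cons /= exprS exprD.
  have -> : forall u v w x y t : R, u * v * (w * x) * (y * t) = (u * w * y) *
    (v * x * t).
    by move=> *; ring.
  apply: ler_pM => //; [exact: normc_ge0|by rewrite prodr_ge0// => y _;
    exact: normc_ge0|].
  exact: normc_subX_le.
rewrite -prodrXl -mulrA; apply: ler_wpM2l.
  by rewrite prodr_ge0// => z _; rewrite exprn_ge0// le_max ler01.
by rewrite ler_pM2r ?exprn_gt0//; apply: ler_weXn2l => //; lra.
Qed.

Local Notation mu := (@lebesgue_measure R).

Lemma le_lne_sqr (y : R) : (lne y%:E <= ((y ^+ 2 - 1) / 2)%:E)%E.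
Proof.
have [y0|y0] := leP y 0; first by rewrite /= y0 leNye.
rewrite lne_EFin// lee_fin.
have : ln (1 + (y ^+ 2 - 1)) <= y ^+ 2 - 1.
  by apply: le_ln1Dx; have := exprn_gt0 2 y0; lra.
by rewrite addrC subrK lnXn// mulr2n; lra.
Qed.

(** The continuous majorant [(|p|^2 - 1) / 2] has mean 0 over every rotated grid of [n] points,
    hence integral 0 by [integral_unit_mean]. *)
Lemma integral_log_circ_le0 (p : {poly R[i]}) n : (0 < n)%N ->
  (forall t : R, \sum_(m < n) normc p.[cis t * ruroot R n ^+ m] ^+ 2 = n%:R) ->
  mu.-integrable `[0%R, 1%R] (log_circ p) ->
  (\int[mu]_(t in `[0%R, 1%R]) log_circ p t <= 0)%E.
Proof.
move=> n0 pn ip; have nR : (n%:R : R) != 0 by rewrite pnatr_eq0 -lt0n.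
pose g (t : R) := (normc p.[cis (2 * pi * t)] ^+ 2 - 1) / 2.
have cg : continuous g.
  have cp : continuous (fun t : R => normc p.[cis (2 * pi * t)]).
    exact: continuous_normc_circ.
  move=> t; apply: cvgM; last exact: cvg_cst.
  by apply: cvgB; [apply: cvgM; exact: cp|exact: cvg_cst].
apply: (@le_trans _ _ (\int[mu]_(t in `[0%R, 1%R]) (g t)%:E)%E).
  apply: le_integral => //; first exact: integrable_unit_itv.
  by move=> t _; exact: le_lne_sqr.
have [x ->] := integral_unit_mean cg n0.
rewrite lee_fin /g -mulr_suml sumrB sumr_const card_ord.
rewrite (eq_bigr (fun j : 'I_n =>
  normc p.[cis (2 * pi * x) * ruroot R n ^+ j] ^+ 2)).
  by rewrite pn subrr mul0r mulr0.
by move=> j _; rewrite circD.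
Qed.

End ZeroCount.

(** * Mahler measure of the Gauss-Fresnel polynomials *)

Section GaussFresnel.
Local Open Scope complex_scope.
Variable R : realType.
Local Notation mu := (@lebesgue_measure R).

Lemma horner_gauss_fresnel n (z : R[i]) : (0 < n)%N ->
  normc (gauss_fresnel R n).[z] = (Num.sqrt n%:R)^-1 * normc (gauss_poly R
    n).[z].
Proof.
move=> n0; rewrite /gauss_fresnel hornerZ normcM normc_real ger0_norm//.
Qed.

Lemma gauss_fresnel_unimodular n j : (0 < n)%N -> ~~ odd n ->
  normc (gauss_fresnel R n).[ruroot R n ^+ j] = 1.
Proof.
move=> n0 en; have s0 : 0 < Num.sqrt (n%:R : R) by rewrite sqrtr_gt0 ltr0n.
rewrite horner_gauss_fresnel//; have := gauss_modulus R j n0 en.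
rewrite -[X in _ = X](@sqr_sqrtr _ n%:R)// => /eqP.
by rewrite eqrXn2 ?normc_ge0 ?(ltW s0)// => /eqP ->; rewrite mulVf// gt_eqF.
Qed.

Lemma gauss_fresnel_parseval n (t : R) : (0 < n)%N ->
  \sum_(m < n) normc (gauss_fresnel R n).[cis t * ruroot R n ^+ m] ^+ 2 = n%:R.
Proof.
move=> n0; have nR : (0 : R) < n%:R by rewrite ltr0n.
rewrite (eq_bigr (fun m : 'I_n =>
  n%:R^-1 * normc (gauss_poly R n).[cis t * ruroot R n ^+ m] ^+ 2)).
  rewrite -mulr_sumr gauss_parseval normc_cis mulrA mulVf ?gt_eqF// mul1r.
  by under eq_bigr do rewrite expr1n; rewrite sumr_const card_ord.
by move=> m _; rewrite horner_gauss_fresnel// exprMn exprVn sqr_sqrtr// ltW.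
Qed.

(** A crude termwise bound is enough: for [s] of order [h / n] its logarithm is of order [h + ln n],
    negligible against [n]. *)
Lemma normc_gauss_fresnel_le n (x : R[i]) (s : R) : (0 < n)%N -> 0 <= s ->
  normc (x - 1) <= s ->
  normc (gauss_fresnel R n).[x] <= n%:R * (1 + s) ^+ n.
Proof.
move=> n0 s0 xs; rewrite horner_gauss_fresnel//.
have s1 : 1 <= Num.sqrt (n%:R : R) by rewrite -[leLHS]sqrtr1 ler_sqrt ?ler1n.
apply: (@le_trans _ _ (normc (gauss_poly R n).[x])).
  by apply: ler_piMl; [exact: normc_ge0|rewrite invf_le1// (lt_le_trans _ s1)].
rewrite horner_gauss_poly; apply: le_trans (normc_sum_le _ _ _) _.
rewrite mulr_natl -[X in _ *+ X](card_ord n) -sumr_const; apply: ler_sum => j _.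
rewrite normc_chirp; have x1 : normc x <= 1 + s.
  rewrite -[x](subrK 1); apply: le_trans (normcD_le _ _) _.
  by rewrite ComplexField.Normc.normc1 addrC lerD2l.
apply: (@le_trans _ _ ((1 + s) ^+ j)); first by apply: lerXn2r;
  rewrite ?nnegrE ?normc_ge0 ?addr_ge0.
by apply: ler_weXn2l; [rewrite lerDl|exact: ltnW].
Qed.

(* With [n = M^8] and [h = M^5], the right-hand side of [gauss_middle_zero] is
   at most [(36 + 128) B^8 M^15], to be compared with [n^2 = M^16]. *)
Lemma gauss_zero_near_one (M : nat) (B : R) (z : R[i]) : ~~ odd M -> 1 <= B ->
  164 * B ^+ 8 < M%:R ->
  B^-1 <= normc z ^+ (M ^ 8) <= B -> (gauss_poly R (M ^ 8)).[z] = 0 ->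
  normc (z - 1) <= 9 * ((M ^ 5)%:R / (M ^ 8)%:R).
Proof.
move=> eM B1 BM zB z0.
have B8 : B <= B ^+ 8 by rewrite -[leLHS]expr1; exact: ler_weXn2l.
have M164 : 164 < M%:R :> R by lra.
have M2 : (2 <= M)%N by rewrite -(ler_nat R); lra.
have n0 : (0 < M ^ 8)%N by rewrite expn_gt0 (leq_trans _ M2).
have h0 : (0 < M ^ 5)%N by rewrite expn_gt0 (leq_trans _ M2).
have en : ~~ odd (M ^ 8) by rewrite oddX.
have hn : (4 * M ^ 5 <= M ^ 8)%N.
  by rewrite (expnD M 3 5) leq_mul2r (@leq_trans (2 ^ 3))// ?orbT// leq_exp2r.
have [t t01 [m mn zE]] := polar_grid z n0.
have r0 : 0 < normc z.
  rewrite lt_neqAle normc_ge0 andbT; apply/eqP => re.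
  by move: zB; rewrite -re expr0n gtn_eqF// leNgt invr_gt0 (lt_le_trans _ B1).
have MM5 : (M <= M ^ 5)%N by rewrite -{1}(expn1 M) leq_exp2l.
have Bh : 1 <= B <= (M ^ 5)%:R.
  rewrite B1 (le_trans B8)// (@le_trans _ _ M%:R) ?ler_nat//.
  have : 0 <= B ^+ 8 by rewrite exprn_ge0// (le_trans _ B1).
  by clear zB zE; lra.
(* Positions near the ends of the orbit are close to 1; the others contradict
   [gauss_middle_zero]. *)
have [mh|mh] := boolP ((m < M ^ 5) || (M ^ 8 - M ^ 5 <= m))%N.
  by rewrite zE; apply: (@gauss_grid_near_one _ _ _ B).
exfalso; move: mh; rewrite negb_or -leqNgt -ltnNge => mh.
have := gauss_middle_zero h0 hn en Bh r0 zB t01 mh _ erefl.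
rewrite -zE => /(_ z0); apply/negP; rewrite -ltNge; clear - BM B1 M2.
rewrite !natrX; have m1 : 1 <= M%:R :> R by rewrite ler1n ltnW.
move: (M%:R) BM m1 => x BM x1.
have x0 : 0 < x by lra.
have B0 : 0 < B by lra.
have -> : 6 * B ^+ 2 * (x ^+ 8 / x ^+ 5) = 6 * B ^+ 2 * x ^+ 3 by field;
  rewrite gt_eqF.
have x35 : x ^+ 3 <= x ^+ 5 by apply: ler_weXn2l.
(* From [x^3 <= x^5], the base is at most [8 * B^2 * x^5]. *)
have E : (6 * B ^+ 2 * x ^+ 3 + 2 * B ^+ 2 * x ^+ 5) ^+ 2 <= 64 * B ^+ 4 * x ^+
  10.
  have -> : 64 * B ^+ 4 * x ^+ 10 = (8 * B ^+ 2 * x ^+ 5) ^+ 2 by ring.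
  have B2 : 0 <= B ^+ 2 by rewrite sqr_ge0.
  have x3 : 0 <= x ^+ 3 by rewrite exprn_ge0// ltW.
  have x5 : 0 <= x ^+ 5 by rewrite exprn_ge0// ltW.
  have := ler_wpM2l B2 x35.
  have p3 : 0 <= B ^+ 2 * x ^+ 3 by exact: mulr_ge0.
  have p5 : 0 <= B ^+ 2 * x ^+ 5 by exact: mulr_ge0.
  by rewrite -!mulrA => h; apply: lerXn2r; rewrite ?nnegrE; clear -p3 p5 h; lra.
have B4 : 0 < B ^+ 4 by rewrite exprn_gt0.
have F : x ^+ 8 * (6 * B ^+ 2 * x ^+ 3) ^+ 2 <= 36 * B ^+ 4 * x ^+ 15.
  have -> : x ^+ 8 * (6 * B ^+ 2 * x ^+ 3) ^+ 2 = 36 * B ^+ 4 * x ^+ 14 by ring.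
  by rewrite ler_pM2l ?mulr_gt0//; apply: ler_weXn2l.
have G : 2 * x ^+ 5 * (6 * B ^+ 2 * x ^+ 3 + 2 * B ^+ 2 * x ^+ 5) ^+ 2 <= 128 *
  B ^+ 4 * x ^+ 15.
  have -> : 128 * B ^+ 4 * x ^+ 15 = 2 * x ^+ 5 * (64 * B ^+ 4 * x ^+ 10)
    by ring.
  by rewrite ler_pM2l// mulr_gt0// exprn_gt0.
apply: (@le_lt_trans _ _ (B ^+ 4 * (36 * B ^+ 4 * x ^+ 15 + 128 * B ^+ 4 * x ^+
  15))).
  by rewrite ler_pM2l// lerD.
have -> : B ^+ 4 * (36 * B ^+ 4 * x ^+ 15 + 128 * B ^+ 4 * x ^+ 15) = 164 * B
  ^+ 8 * x ^+ 15 by ring.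
by rewrite -exprM exprS ltr_pM2r// exprn_gt0.
Qed.

Lemma count_le_in (T : eqType) (a b : pred T) (s : seq T) :
  {in s, forall x, a x -> b x} -> (count a s <= count b s)%N.
Proof.
move=> h; rewrite (@eq_in_count _ a (fun x => a x && (x \in s))) => [|x ->];
  last by rewrite andbT.
by apply: sub_count => x /andP[ax xs]; exact: h.
Qed.

(** After division by [n], the factors [1 + B^-1] cost [B^-1]. The zeros near 1 cost [35 / M], where
    [35 = 8 + 27]: [ln n <= 8 * M] gives [8 / M], and [3 * s = 27 * h / n] gives [27 / M]. *)
Lemma log_mahler_gauss_bounds (M : nat) (B : R) : ~~ odd M -> 1 <= B -> 164 * B
  ^+ 8 < M%:R ->
  ((- (B^-1 + 35 / M%:R))%:E <=
   \int[mu]_(t in `[0%R, 1%R]) log_circ (gauss_fresnel R (M ^ 8)) t <= 0)%E.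
Proof.
move=> eM B1 BM; set p := gauss_fresnel R (M ^ 8).
have B0 : 0 < B by lra.
have M1 : 1 <= M%:R :> R.
  have : 1 <= B ^+ 8 by apply: exprn_ege1.
  by lra.
have M0 : (0 < M)%N by rewrite -(ler1n R).
set n := (M ^ 8)%N in p *; set h := (M ^ 5)%N.
have n0 : (0 < n)%N by rewrite expn_gt0 M0.
have nR : (0 : R) < n%:R by rewrite ltr0n.
have en : ~~ odd n by rewrite oddX.
have p1 : normc p.[1] = 1 by have := gauss_fresnel_unimodular 0 n0 en;
  rewrite expr0.
have pn0 : p != 0.
  by apply/eqP => pe; move: p1; rewrite pe horner0 ComplexField.Normc.normc0 =>
    /eqP; rewrite eq_sym oner_eq0.
have [r pE] := closed_field_poly_normal p.
set a := lead_coef p in pE.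
have a0 : a != 0 by rewrite lead_coef_eq0.
have rn : (size r <= n)%N.
  have : (size p <= n)%N by apply: leq_trans (size_scale_leq _ _) _;
    exact: size_poly.
  by rewrite pE size_scale// size_prod_XsubC; exact: ltnW.
have [ip Jp] := jensen a0 pE.
apply/andP; split; last first.
  by apply: (integral_log_circ_le0 n0) => // t; exact: gauss_fresnel_parseval.
apply: le_trans Jp; rewrite lee_fin.
set X := normc a * _.
have X0 : 0 < X.
  rewrite mulr_gt0 ?normc_gt0//; apply: prodr_gt0_seq => z _.
  by rewrite lt_max ltr01.
have := prod_unity_le n0 B0 rn pE; rewrite -/X.
rewrite (eq_bigr (fun=> 1)) => [|j _]; last exact: gauss_fresnel_unimodular.
rewrite big1//; set k := count _ r => H1.
pose s : R := 9 * (h%:R / n%:R).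
have s0 : 0 <= s by rewrite mulr_ge0// divr_ge0.
have [x xs] := zero_count 1 pE s0; rewrite p1 mul1r; set k' := count _ r => H2.
have kk : (k <= k')%N.
  apply: count_le_in => z zr zB; apply: gauss_zero_near_one zB _ => //.
  have : root p z by rewrite pE rootZ// root_prod_XsubC.
  rewrite /root /p /gauss_fresnel hornerZ mulf_eq0 => /orP[|/eqP//].
  by rewrite -normc_eq0 normc_real normr_eq0 invr_eq0 gt_eqF// sqrtr_gt0.
(* The exceptional zeros enter only through [2 ^+ k], which Jensen's counting on the circle of
   radius [3 * s] about 1 bounds directly. *)
have H3 : 2 ^+ k <= n%:R * (1 + 3 * s) ^+ n.
  apply: (@le_trans _ _ (2 ^+ k')); first by apply: ler_weXn2l => //; lra.
  apply: le_trans H2 _; apply: normc_gauss_fresnel_le => //.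
  by rewrite mulr_ge0.
have BV : 0 < B^-1 by rewrite invr_gt0.
have H4 : 1 <= X ^+ n * (1 + B^-1) ^+ n * (n%:R * (1 + 3 * s) ^+ n).
  apply: le_trans H1 _; rewrite ler_pM2l// mulr_gt0// exprn_gt0//; lra.
have s3 : 0 < 1 + 3 * s by lra.
have b1 : 0 < 1 + B^-1 by lra.
have H5 : 0 <= n%:R * ln X + n%:R * ln (1 + B^-1) + (ln n%:R + n%:R * ln (1 + 3
  * s)).
  have lnn (y : R) : 0 < y -> n%:R * ln y = ln (y ^+ n) by move=> y0;
    rewrite lnXn// mulr_natl.
  have e1 : 0 < X ^+ n by rewrite exprn_gt0.
  have e2 : 0 < (1 + B^-1) ^+ n by rewrite exprn_gt0.
  have e3 : 0 < (1 + 3 * s) ^+ n by rewrite exprn_gt0.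
  rewrite !lnn// -[ln n%:R + _]lnM ?posrE// -[ln (X ^+ n) + _]lnM ?posrE//.
  by rewrite -lnM ?posrE ?mulr_gt0// ln_ge0.
have l1 : ln (1 + B^-1) <= B^-1 by apply: le_ln1Dx; lra.
have l2 : ln (1 + 3 * s) <= 3 * s by apply: le_ln1Dx; lra.
have l3 : ln n%:R <= 8 * M%:R :> R.
  rewrite /n natrX lnXn ?ltr0n// -[ln _ *+ _]mulr_natl ler_pM2l//.
  by apply: ltW; apply: ln_sublinear; rewrite ltr0n.
have MR : 0 < M%:R :> R by lra.
have t1 : M%:R / n%:R <= M%:R^-1 :> R.
  rewrite ler_pdivrMr// ler_pdivlMl// -expr2 /n natrX; exact: ler_weXn2l.
have t2 : h%:R / n%:R <= M%:R^-1 :> R.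
  rewrite ler_pdivrMr// ler_pdivlMl// /n /h !natrX -exprS; exact: ler_weXn2l.
have H6 : 0 <= ln X + B^-1 + (8 * (M%:R / n%:R) + 3 * s).
  have : 0 <= n%:R * (ln X + B^-1 + (8 * (M%:R / n%:R) + 3 * s)).
    apply: le_trans H5 _; rewrite !mulrDr.
    have -> : n%:R * (8 * (M%:R / n%:R)) = 8 * M%:R :> R by field;
      rewrite gt_eqF.
    by apply: lerD; [rewrite lerD2l ler_pM2l|apply: lerD => //;
      rewrite ler_pM2l].
  by rewrite pmulr_rge0.
move: H6 t1 t2; rewrite /s; clear;
  move: (ln X) (B^-1) (M%:R / n%:R) (h%:R / n%:R) (M%:R^-1).
by move=> *; lra.
Qed.

End GaussFresnel.

(** * Convergence along a subsequence *)

Theorem theorem3 (R : realType) :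
  exists nk : nat -> nat,
    [/\ forall k : nat, (0 < nk k)%N,
        {homo nk : i j / (i < j)%N} &
        (fun k : nat => mahler_measure (gauss_fresnel R (nk k))) @ \oo
          --> (1%:E : \bar R)].
Proof.
(* Even bases give even degrees of the form [M ^ 8], for which the cut at [h = M ^ 5] is
   available. *)
exists (fun k => (2 * k.+1) ^ 8)%N; split.
- by move=> k; rewrite expn_gt0.
- by move=> i j ij; rewrite ltn_exp2r// ltn_pmul2l// ltnS.
pose I k : \bar R := (\int[lebesgue_measure]_(t in `[0%R, 1%R])
  log_circ (gauss_fresnel R ((2 * k.+1) ^ 8)) t)%E.
have bounds (B : R) k : 1 <= B -> 164 * B ^+ 8 < (2 * k.+1)%:R ->
    ((- (B^-1 + 35 / (2 * k.+1)%:R))%:E <= I k <= 0)%E.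
  by move=> B1 Bk; apply: log_mahler_gauss_bounds => //; rewrite oddM.
have near_bounds (e : R) : 0 < e -> \forall k \near \oo, ((- e)%:E <= I k <=
  0)%E.
  (* This [B] makes [B^-1 <= e / 2]; beyond [70 / e] the term [35 / M] is at most [e / 2] as
     well. *)
  move=> e0; pose B : R := 1 + 2 / e.
  have B1 : 1 <= B by rewrite lerDl divr_ge0// ltW.
  have [N [NB Ne]] : exists N : nat, 164 * B ^+ 8 < N%:R /\ 70 / e < N%:R.
    exists (Num.truncn (164 * B ^+ 8 + 70 / e)).+1.
    have B8 : 0 <= 164 * B ^+ 8 by rewrite mulr_ge0// exprn_ge0//; lra.
    have e7 : 0 <= 70 / e by rewrite divr_ge0// ltW.
    have h := truncnS_gt (164 * B ^+ 8 + 70 / e).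
    by split; apply: le_lt_trans h; rewrite ?lerDl ?lerDr.
  exists N => // k /= Nk.
  have Nk' : N%:R <= (2 * k.+1)%:R :> R
    by rewrite ler_nat (leq_trans Nk)// (leq_trans (leqnSn k))// leq_pmull.
  have /andP[Il Iu] := bounds B k B1 (lt_le_trans NB Nk').
  rewrite Iu andbT; apply: le_trans Il; rewrite lee_fin lerN2.
  have kR : (0 : R) < (2 * k.+1)%:R by rewrite ltr0n.
  have b1 : B^-1 <= e / 2.
    have B0 : 0 < B := lt_le_trans ltr01 B1.
    by rewrite -[e / 2]invrK invf_div lef_pV2 ?posrE ?divr_gt0// /B lerDr.
  have b2 : 35 / (2 * k.+1)%:R <= e / 2.
    rewrite ler_pdivrMr//; have := lt_le_trans Ne Nk'; rewrite ltr_pdivrMr//.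
    by move: ((2 * k.+1)%:R) => x; lra.
  by rewrite [leRHS]splitr; exact: lerD.
have mE k : mahler_measure (gauss_fresnel R ((2 * k.+1) ^ 8)) = expeR (I k) by
  [].
under eq_fun do rewrite mE.
(* The bounds with [e = 1] already show that the integrals are eventually finite. Convergence then
   follows from [1 + x <= expR x <= 1] for [- e <= x <= 0]. *)
apply: cvg_EFin.
  apply: filterS (near_bounds 1 ltr01) => k.
  by case: (I k) => [x||] //=; rewrite ?andbF.
apply/cvgrPdist_le => e e0; apply: filterS (near_bounds e e0) => k /=.
case: (I k) => [x||]; rewrite ?leye_eq ?leeNy_eq ?andbF// !lee_fin =>
  /andP[xl xu] /=.
have := expR_ge1Dx x; have : expR x <= expR 0 by rewrite ler_expR.
by rewrite expR0 ler_norml => h1 h2; apply/andP; split; lra.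
Qed.
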